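(* For an integer $n\geq 3$, let $\Theta(n)$ be the number of steps of the following recursive search procedure run for $n$ from $(p,s,i)=(1,0,0)$, where a step is one evaluation of the comparison between $p'$ and $s'+n-(i+1)$. The procedure, called with $(p,s,i)$ and candidate $(a_1,\dots,a_i)$, lets $m:=a_i$ if $i\geq1$ and $m:=n$ if $i=0$; for each $a'=2,\dots,m$ it sets $s':=s+a'$, $p':=pa'$ and: if $p'>s'+n-(i+1)$ it discards $a'$; if $p'=s'+n-(i+1)$ it records $(a_1,\dots,a_i,a',1,\dots,1)\in\mathbb N^n$ as a solution; if $p'<s'+n-(i+1)$ it calls itself recursively with $(p',s',i+1)$ and candidate $(a_1,\dots,a_i,a')$. Then $\Theta(n)$ is bounded above and below by positive constant multiples of the total number of non-increasing positive integer solutions of $\prod_{j=1}^{n'}a_j=\sum_{j=1}^{n'}a_j$ over all lengths $n'\leq n$, and, with $A(n)=\dfrac{n\,e^{2\sqrt{\log n}}}{(\log n)^{3/4}}$, there exist constants $0<b<B$ such that $b\leq \lim_{n\to\infty}\Theta(n)/A(n)\leq B$.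
   Context: All sequences are of positive integers and non-increasing; $\mathbb N$ denotes the positive integers; $\log$ is the natural logarithm.
   Formalization: When p'>s'+n-(i+1), the loop over a' ends, discarding all larger a' without further comparisons (otherwise Θ(n)≥n(n-1)/2 and the claim fails); solutions are counted over lengths 2≤n'≤n, since n'=1 gives infinitely many. *)

(* Defs.v *)
From mathcomp Require Import all_boot all_order all_algebra.
From mathcomp Require Import finmap zify.
From mathcomp Require Import all_classical all_reals all_analysis.
Import Order.TTheory GRing.Theory Num.Theory.
Import numFieldNormedType.Exports.
Set Implicit Arguments.
Unset Strict Implicit.
Unset Printing Implicit Defensive.

Local Open Scope nat_scope.

Definition is_solution (a : seq nat) : bool :=
  [&& sorted geq a, all (leq 1) a & \prod_(x <- a) x == \sum_(x <- a) x].

(* Length 1 is left out: there every positive integer is a solution, and the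
   total would be infinite. *)
Definition solutions_le (n : nat) : set (seq nat) :=
  [set a | (2 <= size a <= n) && is_solution a].

Definition nb_solutions_le (n : nat) : nat := #|` fset_set (solutions_le n)|.

Lemma solution_bound (n : nat) (a : seq nat) :
  solutions_le n a -> all (geq (n * n)) a.
Proof.
case: a => [//|x [//|y l]] /andP[/andP[_ sz] /and3P[so /= /and3P[x1 y1 l1]]].
rewrite !big_cons => /eqP e.
have geq_tr : transitive geq by move=> u v w /= h1 h2; apply: leq_trans h2 h1.
have leall (z : nat) (r : seq nat) : path geq z r -> all (geq z) r.
  by rewrite path_sortedE// => /andP[].
have sumle (z : nat) (r : seq nat) :
    all (geq z) r -> \sum_(i <- r) i <= z * size r.
  elim: r => [|u r IH] /=; first by rewrite big_nil.
  by case/andP=> uz /IH; rewrite big_cons mulnS; apply: leq_add.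
have prodpos (r : seq nat) : all (leq 1) r -> 0 < \prod_(i <- r) i.
  elim: r => [|u r IH] /=; first by rewrite big_nil.
  by case/andP=> u0 /IH; rewrite big_cons muln_gt0 u0.
move: so => /= /andP[yx yl].
have xall : all (geq x) (y :: l) by apply: leall; rewrite /= yx yl.
have yall := leall _ _ yl.
have sx := sumle _ _ xall; have sy := sumle _ _ yall.
have Ppos := prodpos _ l1.
move: sx sz; rewrite big_cons /= => sx sz.
move: e sx sy Ppos.
set P := \prod_(i <- l) i; set S := \sum_(i <- l) i => e sx sy Ppos.
have y2 : 2 <= y.
  rewrite ltn_neqAle y1 andbT; apply/eqP => y1'; subst y.
  have P1 : P = 1.
    rewrite /P big1_seq// => u /andP[_ ul].
    move: (allP yall u ul) (allP l1 u ul) => /= u1 u1'.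
    by apply/eqP; rewrite eqn_leq; apply/andP; split.
  by move: e; rewrite P1 => e; lia.
have yP : y * P <= n.
  have : x * (y * P) <= x * n.
    by rewrite e; apply: (@leq_trans (x * (size l).+2)); nia.
  by rewrite leq_pmul2l.
have yn : y <= n by apply: leq_trans yP; nia.
have xn : x <= n * n.
  have : x * 2 <= x * (y * P) by apply: leq_mul => //; nia.
  rewrite e => h; have {h} : x <= y + S by lia.
  by move=> /leq_trans; apply; apply: (@leq_trans (y * (size l).+1)); nia.
rewrite /= xn (leq_trans yx xn) /=.
by apply/allP => u ul; apply: leq_trans xn; apply: (allP xall); rewrite inE ul orbT.
Qed.

Lemma finite_solutions_le (n : nat) : finite_set (solutions_le n).
Proof.
pose f (b : n.-bseq 'I_(n * n).+1) : seq nat := map val b.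
apply: (@sub_finite_set _ _ (f @` setT)); last exact/finite_image/finite_finset.
move=> a sa; have /allP ba := solution_bound sa.
have sz : size (map (@inord (n * n)) a) <= n.
  by rewrite size_map; case/andP: sa => /andP[].
exists (Bseq sz) => //=; rewrite /f /= -map_comp.
rewrite -[RHS]map_id; apply/eq_in_map => u ua /=.
by rewrite inordK// ltnS; apply: ba.
Qed.

Lemma in_solutions_le (n : nat) (a : seq nat) :
  (a \in fset_set (solutions_le n)) = (2 <= size a <= n) && is_solution a.
Proof.
rewrite in_fset_set; last exact: finite_solutions_le.
by apply/idP/idP; rewrite inE.
Qed.

(* The outcome of a run: number of comparisons made, and recorded solutions. *)
Definition outcome : Type := (nat * seq (seq nat))%type.

Definition outcome_cat (x y : outcome) : outcome := (x.1 + y.1, x.2 ++ y.2).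

(* The loop of the call (p, s, i) with candidate c over the values a' listed in
   l (in increasing order); [call] performs the recursive calls.  As p' - s' is
   nondecreasing in a', an a' with p' > s' + n - (i + 1) rules out all larger
   ones, so the loop ends there, without comparing them. *)
Fixpoint loop (call : nat -> nat -> nat -> seq nat -> outcome)
    (n p s i : nat) (c l : seq nat) : outcome :=
  if l is a' :: l' then
    let s' := s + a' in
    let p' := p * a' in
    let t := s' + n - i.+1 in
    if t < p' then (1, [::])
    else
      let here :=
        if p' == t then [:: rcons c a' ++ nseq (n - i.+1) 1] else [::] in
      let below :=
        if p' < t then call p' s' i.+1 (rcons c a') else (0, [::]) in
      outcome_cat (1, here) (outcome_cat below (loop call n p s i c l'))
  else (0, [::]).

(* [fuel] bounds the depth of the recursion; see [search_fuel]. *)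
Fixpoint search (fuel n p s i : nat) (c : seq nat) : outcome :=
  if fuel is fuel'.+1 then
    let m := if 0 < i then last 0 c else n in
    loop (search fuel' n) n p s i c (iota 2 m.-1)
  else (0, [::]).

Definition run (n : nat) : outcome := search n n 1 0 0 [::].

Definition Theta (n : nat) : nat := (run n).1.

Lemma loop_eq (call1 call2 : nat -> nat -> nat -> seq nat -> outcome)
    (n p s i : nat) (c l : seq nat) :
  (forall a', a' \in l -> p * a' < s + a' + n - i.+1 ->
     call1 (p * a') (s + a') i.+1 (rcons c a') =
     call2 (p * a') (s + a') i.+1 (rcons c a')) ->
  loop call1 n p s i c l = loop call2 n p s i c l.
Proof.
elim: l => [//|a l IH] H /=; case: ifP => // _.
rewrite IH => [|a' a'l]; last by apply: H; rewrite inE a'l orbT.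
by case: (boolP (p * a < _)) => // lt_t; rewrite (H a (mem_head a l) lt_t).
Qed.

Lemma search_fuel_gen (n f1 f2 p s i : nat) (c : seq nat) :
  i < n -> n - i <= f1 -> n - i <= f2 -> s <= p -> (0 < i -> 2 <= p) ->
  (i = 0 -> p = 1 /\ s = 0) ->
  search f1 n p s i c = search f2 n p s i c.
Proof.
elim: f1 f2 p s i c => [|f1 IH] [|f2] p s i c ltin le1 le2 sp p2 i0;
  try by move: ltin; rewrite -subn_gt0; move: le1 le2; case: (n - i).
rewrite /=; apply: loop_eq => a'; rewrite mem_iota => /andP[a2 _] lt_t.
have sp' : s + a' <= p * a'.
  case: (posnP i) => [/i0[-> ->]|/p2 pge2]; first by rewrite add0n mul1n.
  have : p + a' <= p * a' by nia.
  by apply: leq_trans; rewrite leq_add2r.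
have p2' : 2 <= p * a'.
  case: (posnP i) => [/i0[-> _]|/p2 pge2]; first by rewrite mul1n.
  by nia.
by apply: IH => //; lia.
Qed.

Lemma search_fuel (n k : nat) : 0 < n -> search (n + k) n 1 0 0 [::] = run n.
Proof. by move=> n0; apply: search_fuel_gen => //; lia. Qed.

Local Open Scope ring_scope.

Definition A (R : realType) (n : nat) : R :=
  n%:R * expR (2 * Num.sqrt (ln n%:R)) / ln n%:R `^ (3 / 4).

(* Main.v *)
(* Let F(x) be the number of multiplicative partitions with product <= x and,
   with v = log x, put M(v) = F(e^v) e^-v and P(v) = int_0^v (v - t) M(t) dt.
   Counting each part of each partition weighted by its logarithm yields
     sum_a log (prod a) = sum_a psi (x / prod a),
     psi(y) = sum_(k^j <= y) log k = y log y - y + O(y^(3/4)),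
   which says that P'' = M satisfies P'' = (1 + O(1/v)) P / v. The functions
   v^(1/4) exp (2 sqrt v -+ 2 K / sqrt v) satisfy this equation up to an error
   of definite sign, so that their Wronskians with P are monotone. Therefore
   P(v) ~ c v^(1/4) exp (2 sqrt v) for some c > 0, and F(n) ~ c A(n).

   The search makes one comparison per candidate that fits and one per call
   that ends on a failed comparison. Up to O(n), the former are the solutions
   of length <= n, and the latter are the solutions of length <= n - 1 minus
   the solutions of length <= n whose two smallest entries > 1 coincide. The
   solutions of length <= n are, up to o(A(n)), the multiplicative partitions
   with product <= n; those whose smallest part d is repeated are counted by
   F_d(n / d^2), where F_d counts the partitions into parts >= d, and
   F_(d+1)(n) = F_d(n) - F_d(n / d). *)
Require Import Defs.
From mathcomp Require Import all_boot all_order all_algebra.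
From mathcomp Require Import finmap zify ring lra.
From mathcomp Require Import all_classical all_reals all_analysis.
Import Order.TTheory GRing.Theory Num.Theory.
Import numFieldNormedType.Exports.
Set Implicit Arguments.
Unset Strict Implicit.
Unset Printing Implicit Defensive.
Local Open Scope classical_set_scope.
Local Open Scope ring_scope.

(** * Multiplicative partitions *)

(** A limit is claimed, so every comparison may lose only a factor tending to 1. An error O(1/v) in
    the equation is harmless in this respect, since it alters the comparison functions by exp (O(1 /
    sqrt v)); the difficulty is to reach it. Put h = v - log (prod a). The main term of psi matches
    the kernel h - 1 + e^-h of P, but the errors y^(3/4) add up to Q = sum_a e^(-h/4) / prod a, and
    the kernel vanishes at h = 0, so that no termwise comparison bounds Q by P / v. The logarithmic
    identity is therefore applied once more, with the weight m^(-3/4), and yields v Q <= Q + O(P). M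
    jumps at each v = log N while P and P' do not, hence a treatment by glued pieces. The variable x
    = sqrt v makes the logarithmic derivatives rational. Repeated smallest parts require an
    interchange of limits: each F_d (n / d^2) is asymptotic to a multiple of A(n), but d is
    unbounded. Lowering one of two equal smallest parts > D in D ways bounds the remainder by F(n) /
    D, uniformly in n. *)

Local Notation prodn a := (\prod_(x <- a) x)%N.
Local Notation sumnn a := (\sum_(x <- a) x)%N.

Section BoundedSeqs.
Local Open Scope nat_scope.

(** A finite universe out of which [mparts] and [goods] are filtered. As duplicate-free lists, these
    are counted by [size] and compared through injections. *)
Definition bseqs (n : nat) : seq (seq nat) :=
  map (fun b : n.-bseq 'I_n.+1 => map val b) (enum {: n.-bseq 'I_n.+1}).

Lemma bseqs_uniq n : uniq (bseqs n).
Proof.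
rewrite map_inj_uniq ?enum_uniq// => b c h.
by apply/val_inj; apply: (inj_map val_inj).
Qed.

Lemma mem_bseqs n a : (a \in bseqs n) = (size a <= n) && all (geq n) a.
Proof.
apply/mapP/andP => [[b _ ->]|[sa /allP la]].
  rewrite size_map; split; first exact: size_bseq.
  by apply/allP => _ /mapP[i _ ->] /=; rewrite -ltnS.
have sz : size (map (@inord n) a) <= n by rewrite size_map.
exists (Bseq sz); first by rewrite mem_enum.
rewrite /= -map_comp -[LHS]map_id; apply/eq_in_map => u ua /=.
by rewrite inordK// ltnS; apply: la.
Qed.

End BoundedSeqs.

Section Products.
Local Open Scope nat_scope.
Implicit Types (a : seq nat) (k x : nat).

Lemma geq_trans : transitive geq.
Proof. by move=> u v w /= h1 h2; apply: leq_trans h2 h1. Qed.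

Lemma geq_total : total geq.
Proof. by move=> x y /=; exact: leq_total. Qed.

Lemma geq_anti : antisymmetric geq.
Proof. by move=> x y /=; rewrite andbC => /anti_leq. Qed.

Lemma expn_size_prod d a : all (leq d) a -> d ^ size a <= prodn a.
Proof.
elim: a => [|x a IH] /=; first by rewrite big_nil.
by case/andP=> dx /IH; rewrite big_cons expnS; exact: leq_mul.
Qed.

Lemma prod_ge1 a : all (leq 1) a -> 1 <= prodn a.
Proof. by move=> /expn_size_prod; rewrite exp1n. Qed.

Lemma all_leq_trans d e a : e <= d -> all (leq d) a -> all (leq e) a.
Proof. by move=> ed; apply: sub_all => x; exact: leq_trans. Qed.

Lemma size_lt_prod a : all (leq 2) a -> size a < prodn a.
Proof. by move=> /expn_size_prod; apply: leq_trans; exact: ltn_expl. Qed.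

Lemma mem_leq_prod a x : all (leq 1) a -> x \in a -> x <= prodn a.
Proof.
elim: a => [//|y a IH] /= /andP[y1 a1]; rewrite inE big_cons => /predU1P[->|xa].
  by rewrite leq_pmulr// prod_ge1.
by apply: leq_trans (IH a1 xa) _; rewrite leq_pmull.
Qed.

(** Since u + v <= u v + 1 for u, v >= 1, merging two entries into their product lowers the sum by
    at most 1. *)
Lemma sum_lt_prod_size a : all (leq 1) a -> sumnn a < prodn a + size a.
Proof.
elim: a => [|y a IH] /=; first by rewrite !big_nil.
case/andP=> y1 a1; have := IH a1; have := prod_ge1 a1.
by rewrite !big_cons /=; nia.
Qed.

End Products.

Section Mparts.
Local Open Scope nat_scope.
Implicit Types (a : seq nat) (k d N : nat).

Definition mparts d N : seq (seq nat) :=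
  [seq a <- bseqs N | [&& sorted geq a, all (leq d) a & prodn a <= N]].

Lemma mparts_uniq d N : uniq (mparts d N).
Proof. by rewrite filter_uniq// bseqs_uniq. Qed.

Lemma mem_mparts d N a : 2 <= d ->
  (a \in mparts d N) = [&& sorted geq a, all (leq d) a & prodn a <= N].
Proof.
move=> d2; rewrite mem_filter mem_bseqs; apply: andb_idr => /and3P[_ ad aN].
have a2 := all_leq_trans d2 ad.
rewrite (leq_trans (ltnW (size_lt_prod a2)))//=; apply/allP => x xa /=.
by apply: leq_trans aN; apply: mem_leq_prod => //; exact: all_leq_trans a2.
Qed.

Definition insert_parts k j a := sort geq (nseq j k ++ a).

Lemma perm_insert_parts k j a : perm_eq (insert_parts k j a) (nseq j k ++ a).
Proof. exact/permPl/perm_sort. Qed.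

Lemma prod_insert_parts k j a : prodn (insert_parts k j a) = prodn a * k ^ j.
Proof.
rewrite (perm_big _ (perm_insert_parts k j a)) big_cat/= mulnC; congr (_ * _).
by rewrite big_nseq; elim: j => //= j ->; rewrite expnS.
Qed.

(** Insertion and removal of j copies of k are inverse to each other. The case j = 1, k = d gives
    the recursion in d; all k and j together give the logarithmic identity. *)
Lemma insert_parts_perm k j d N : 2 <= d <= k ->
  perm_eq [seq a <- mparts d N | j <= count_mem k a]
    (map (insert_parts k j) [seq a <- mparts d N | prodn a * k ^ j <= N]).
Proof.
move=> /andP[d2 dk]; apply: uniq_perm.
- by rewrite filter_uniq// mparts_uniq.
- rewrite map_inj_in_uniq; first by rewrite filter_uniq// mparts_uniq.
  move=> a b.
  rewrite !(mem_filter _ _ (mparts d N)) !mem_mparts// => /andP[_ /and3P[sa _ _]].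
  move=> /andP[_ /and3P[sb _ _]] h.
  apply: (sorted_eq geq_trans geq_anti) => //.
  have := perm_insert_parts k j b; rewrite -h => hb.
  have := perm_insert_parts k j a; rewrite perm_sym => ha.
  by have := perm_trans ha hb; rewrite perm_cat2l.
move=> b; apply/idP/mapP => [|[a]]; last first.
  rewrite !(mem_filter _ _ (mparts d N)) !mem_mparts// => /andP[akN /and3P[sa ad aN]] ->.
  rewrite prod_insert_parts akN (sort_sorted geq_total) andbT /=.
  rewrite (permP (perm_insert_parts k j a)) count_cat count_nseq /= eqxx mul1n.
  rewrite leq_addr /= (perm_all _ (perm_insert_parts k j a)) all_cat ad andbT.
  by rewrite all_nseq dk orbT.
rewrite mem_filter mem_mparts// => /andP[jb /and3P[sb bd bN]].
have [a sa hab] : exists2 a, subseq a b & perm_eq b (nseq j k ++ a).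
  elim: j jb => [|j IH] jb; first by exists b.
  have [a sa hab] := IH (ltnW jb).
  have ka : k \in a.
    move: jb; rewrite (permP hab) count_cat count_nseq /= eqxx mul1n.
    by rewrite -[X in X < _]addn0 ltn_add2l -has_count has_pred1.
  exists (rem k a); first exact: subseq_trans (rem_subseq _ _) sa.
  apply: perm_trans hab _; rewrite -addn1 nseqD -catA perm_cat2l.
  exact: perm_to_rem.
have pab : prodn a * k ^ j = prodn b.
  by rewrite -prod_insert_parts; apply: perm_big;
     apply: perm_trans (perm_insert_parts _ _ _) _; rewrite perm_sym.
exists a; last first.
  apply: (sorted_eq geq_trans geq_anti) => //; first exact: sort_sorted geq_total _.
  by rewrite perm_sym; apply: perm_trans (perm_insert_parts _ _ _) _; rewrite perm_sym.
rewrite mem_filter pab bN mem_mparts// (subseq_sorted geq_trans sa)//=.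
apply/andP; split.
  by apply/allP => x xa; apply: (allP bd); exact: mem_subseq sa _ xa.
by apply: leq_trans bN; rewrite -pab leq_pmulr// expn_gt0 (leq_trans _ dk) ?(ltnW d2).
Qed.

Local Open Scope ring_scope.

(** The multiplicity of k is the number of j >= 1 not exceeding it. Cutting k and j at N is harmless
    because the parts and the length are at most the product. *)
Lemma sum_count (R : nzRingType) (f : nat -> R) a N :
  all (leq 2) a -> (prodn a <= N)%N ->
  \sum_(x <- a) f x =
  \sum_(2 <= k < N.+1) \sum_(1 <= j < N.+1 | (j <= count_mem k a)%N) f k.
Proof.
move=> a2 aN.
have bound x : x \in a -> (2 <= x < N.+1)%N.
  move=> xa; rewrite (allP a2 x xa) ltnS; apply: leq_trans aN.
  by apply: mem_leq_prod => //; exact: all_leq_trans a2.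
transitivity (\sum_(x <- a) \sum_(2 <= k < N.+1) (if x == k then f k else 0)).
  rewrite big_seq [RHS]big_seq; apply: eq_bigr => x /bound hx.
  rewrite -big_mkcond /= -[RHS]big_filter.
  rewrite (_ : seq.filter _ _ = [:: x]) ?big_seq1//.
  rewrite -(filter_pred1_uniq (iota_uniq 2 (N.+1 - 2)) (x := x)).
    by apply: eq_filter => k /=; rewrite eq_sym.
  by rewrite mem_iota; lia.
rewrite exchange_big /=; apply: eq_bigr => k _.
rewrite -big_mkcond /=.
rewrite -[LHS]big_filter big_const_seq -[RHS]big_filter big_const_seq !count_predT.
congr (iter _ _ _); rewrite !size_filter.
rewrite (eq_count (a2 := pred1 k))//.
set c := count_mem k a.
have cN : (c <= N)%N.
  apply: leq_trans (count_size _ _) _.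
  by apply: leq_trans aN; exact: ltnW (size_lt_prod a2).
transitivity (size (iota 1 c)); first by rewrite size_iota.
rewrite -size_filter /index_iota subn1 /= -(subnKC cN) iotaD filter_cat size_cat.
rewrite (_ : seq.filter _ (iota 1 c) = iota 1 c); last first.
  by apply/all_filterP/allP => j; rewrite mem_iota; lia.
rewrite (_ : seq.filter _ _ = [::]) ?addn0//.
by rewrite -[RHS](filter_pred0 (iota (1 + c) (N - c))); apply: eq_in_filter => j;
   rewrite mem_iota /=; lia.
Qed.

(* The identity [D' = (D'/D) * D] for the Dirichlet series [D] of
   multiplicative partitions, weighted by [K]. *)
Lemma mparts_log_identity (R : comNzRingType) (f K : nat -> R) N :
  \sum_(a <- mparts 2 N) (\sum_(x <- a) f x) * K (prodn a) =
  \sum_(a <- mparts 2 N) \sum_(2 <= k < N.+1)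
    \sum_(1 <= j < N.+1 | (prodn a * k ^ j <= N)%N) f k * K (prodn a * k ^ j)%N.
Proof.
transitivity (\sum_(a <- mparts 2 N) \sum_(2 <= k < N.+1)
    \sum_(1 <= j < N.+1 | (j <= count_mem k a)%N) f k * K (prodn a)).
  rewrite big_seq [RHS]big_seq; apply: eq_bigr => a.
  rewrite mem_mparts// => /and3P[_ a2 aN].
  rewrite (sum_count f a2 aN) mulr_suml; apply: eq_bigr => k _.
  by rewrite mulr_suml.
rewrite exchange_big [RHS]exchange_big /=; apply: eq_big_nat => k /andP[k2 _].
under eq_bigr do rewrite big_mkcond /=.
under [RHS]eq_bigr do rewrite big_mkcond /=.
rewrite exchange_big [RHS]exchange_big /=; apply: eq_bigr => j _.
rewrite -!big_mkcond /= -[LHS]big_filter -[RHS]big_filter.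
rewrite (perm_big _ (insert_parts_perm j N (d := 2) (k := k) k2)) big_map.
by apply: eq_bigr => a _; rewrite prod_insert_parts.
Qed.

End Mparts.

(** * The search procedure *)

Section Search.
Local Open Scope nat_scope.
Variable n : nat.
Implicit Types (p s i m f : nat) (t c : seq nat).

(** The test of the loop, freed of its truncated subtraction. *)
Let fits p s i x := p * x + i.+1 <= s + x + n.

Lemma leq_sub_fits p s i x : 0 < p -> 0 < x ->
  (s + x + n - i.+1 < p * x) = ~~ fits p s i x.
Proof. by move=> p0 x0; rewrite /fits; nia. Qed.

Lemma fits_down p s i x y : 0 < p -> x <= y -> fits p s i y -> fits p s i x.
Proof. by rewrite /fits => p0 xy; nia. Qed.

(* The candidates, relative to the initial one, for which [search] is called. *)
Fixpoint nodes f p s i m : seq (seq nat) :=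
  if f is f'.+1 then
    [::] :: [seq x :: t | x <- [seq x <- iota 2 m.-1 | p * x + i.+1 < s + x + n],
                          t <- nodes f' (p * x) (s + x) i.+1 x]
  else [::].

Lemma nodes_uniq f p s i m : uniq (nodes f p s i m).
Proof.
elim: f p s i m => //= f IH p s i m; apply/andP; split.
  by apply/allpairsPdep => -[x [t [_ _]]].
apply: allpairs_uniq_dep => [|x _|[x t] [y u] _ _ /= [-> ->]] //.
  by rewrite filter_uniq// iota_uniq.
Qed.

Definition strict p s i t := p * prodn t + (i + size t) < s + sumnn t + n.

(** A single test on the whole of t remains: by [sum_lt_prod_size] it implies the tests on all
    nonempty prefixes of t. *)
Lemma mem_nodes f p s i m t : 0 < p -> (t \in nodes f p s i m) =
  [&& size t < f, path geq m t, all (leq 2) t & (t == [::]) || strict p s i t].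
Proof.
elim: f p s i m t => [|f IH] p s i m t p0; first by rewrite in_nil ltn0.
rewrite /= inE; case: t => [|x t].
  by rewrite eqxx.
rewrite /= ltnS; apply/allpairsPdep/idP => [[y [u [+ + [-> ->]]]]|].
  rewrite mem_filter mem_iota => /andP[h /andP[y2 ym]].
  rewrite IH ?muln_gt0 ?p0 ?(ltnW y2)// => /and4P[-> -> -> hu].
  rewrite y2 /= andbT; apply/andP; split; first by lia.
  case/orP: hu => [/eqP->|].
    by rewrite /strict /= !big_seq1 addn1.
  by rewrite /strict !big_cons /=; nia.
move=> /and4P[tf /andP[xm xt] /andP[x2 t2] hs].
have t1 : 0 < prodn t by apply: prod_ge1; apply: all_leq_trans t2.
have sp := sum_lt_prod_size (all_leq_trans (isT : 1 <= 2) t2).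
exists x, t; split => //.
  rewrite mem_filter mem_iota x2 /=; apply/andP; split; last by lia.
  move: hs; rewrite /strict !big_cons /=.
  by nia.
rewrite IH ?muln_gt0 ?p0 ?(ltnW x2)// tf xt t2 /=; apply/orP; right.
by move: hs; rewrite /strict !big_cons /=; nia.
Qed.

(** By monotonicity of the test, the loop compares all values that fit and then, if the range has a
    value that does not fit, the one at which it stops. *)
Definition comparisons p s i m :=
  count (fits p s i) (iota 2 m.-1) + has (predC (fits p s i)) (iota 2 m.-1).

Lemma loopE call p s i c b k : 0 < p -> 0 < b ->
  (loop call n p s i c (iota b k)).1 =
  count (fits p s i) (iota b k) + has (predC (fits p s i)) (iota b k) +
  \sum_(x <- iota b k | p * x + i.+1 < s + x + n)
     (call (p * x) (s + x) i.+1 (rcons c x)).1.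
Proof.
move=> p0; elim: k b => [|k IH] b b0 /=; first by rewrite big_nil.
rewrite leq_sub_fits// big_cons; case: (boolP (fits p s i b)) => hb /=.
  rewrite IH//; set S := \sum_(_ <- _ | _) _; set C := count _ _.
  have -> : (p * b < s + b + n - i.+1) = (p * b + i.+1 < s + b + n) by lia.
  by case: ifP => _ /=; lia.
have nf x : b < x -> ~~ fits p s i x.
  by move=> bx; apply: contra hb; apply: fits_down => //; exact: ltnW.
rewrite (_ : count _ _ = 0); last first.
  apply/eqP; rewrite -leqn0 leqNgt -has_count; apply/hasPn => x.
  by rewrite mem_iota => /andP[bx _]; exact: nf.
rewrite ifF; last by move: hb; rewrite /fits; lia.
rewrite big1_seq ?addn0// => x /andP[hx]; rewrite mem_iota => /andP[bx _].
by have := nf _ bx; rewrite /fits; lia.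
Qed.

Lemma searchE f p s i c : 0 < p ->
  let m := if 0 < i then last 0 c else n in
  (search f n p s i c).1 = \sum_(t <- nodes f p s i m)
    comparisons (p * prodn t) (s + sumnn t) (i + size t) (last m t).
Proof.
elim: f p s i c => [|f IH] p s i c p0 /=; first by rewrite big_nil.
rewrite loopE// big_cons /= !big_nil muln1 !addn0 big_allpairs_dep big_filter.
congr (_ + _); rewrite big_seq_cond [RHS]big_seq_cond; apply: eq_bigr => x.
rewrite mem_iota => /andP[/andP[x2 _] _].
rewrite IH ?muln_gt0 ?p0 ?(ltnW x2)//= last_rcons; apply: eq_bigr => t _.
by rewrite !big_cons !mulnA !addnA addSnnS.
Qed.

End Search.

Section Goods.
Local Open Scope nat_scope.
Implicit Types (n x : nat) (a b t : seq nat).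

(* The sequences with at least two entries [>= 2] that become solutions of
   length [<= n] once padded with ones. *)
Definition goods n : seq (seq nat) := [seq a <- bseqs n |
  [&& 1 < size a, sorted geq a, all (leq 2) a & prodn a + size a <= n + sumnn a]].

Lemma goods_uniq n : uniq (goods n).
Proof. by rewrite filter_uniq// bseqs_uniq. Qed.

(** With Q = prod a, [sum_lt_prod_size] on the tail turns the condition into x Q - x - Q + 1 < n,
    whose left side factors. *)
Lemma good_bounds n x a : a != [::] -> path geq x a -> all (leq 2) (x :: a) ->
  prodn (x :: a) + (size a).+1 <= n + sumnn (x :: a) ->
  (x.-1 * (prodn a).-1 < n) /\ 2 <= prodn a.
Proof.
case: a => [//|y a] _ /= _ /and3P[x2 y2 a2].
have a1 := all_leq_trans (isT : 1 <= 2) a2.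
have := @sum_lt_prod_size (y :: a); rewrite /= a1 (ltnW y2) => /(_ isT).
have := prod_ge1 a1; rewrite !big_cons /=.
set P := prodn a; set S := sumnn a => P0 h1 h2.
have yP : 2 <= y * P by nia.
split=> //; move: h1 h2 yP; rewrite mulnA -[x * y * P]mulnA; move: (y * P) => Q *.
by nia.
Qed.

Lemma mem_goods n a : (a \in goods n) =
  [&& 1 < size a, sorted geq a, all (leq 2) a & prodn a + size a <= n + sumnn a].
Proof.
rewrite mem_filter mem_bseqs; apply: andb_idr => /and4P[].
case: a => [//|x [//|y t]]; set a := y :: t => _ sa /= a2 h.
have a0 : a != [::] by [].
have [h1 h2] := good_bounds a0 sa a2 h.
have b2 : all (leq 2) a by case/andP: a2.
have x2 : 1 < x by case/andP: a2.
have b1 := all_leq_trans (isT : 1 <= 2) b2.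
have xn : x <= n by nia.
have pn : prodn a <= n by nia.
have an : all (geq n) a.
  by apply/allP => z za; apply: leq_trans pn; exact: mem_leq_prod za.
by apply/andP; split; [exact: leq_trans (size_lt_prod b2) pn|apply/andP].
Qed.

Lemma goods_head n x a : x :: a \in goods n -> x <= n.
Proof.
rewrite mem_goods; case: a => [//|y t]; set a := y :: t => /and4P[_ sa a2 h].
have a0 : a != [::] by [].
have [h1 h2] := good_bounds a0 sa a2 h.
have x2 : 1 < x by case/andP: a2.
by nia.
Qed.

Definition singles n : seq (seq nat) := [seq [:: x] | x <- iota 2 n.-1].

Lemma singles_uniq n : uniq (singles n).
Proof. by rewrite map_inj_uniq ?iota_uniq// => x y []. Qed.

Lemma singles_goods_uniq n k : uniq (singles n ++ goods k).
Proof.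
rewrite cat_uniq singles_uniq goods_uniq andbT; apply/hasPn => a.
by rewrite mem_goods => /and4P[h _ _ _]; apply/mapP => -[x _] ha; rewrite ha in h.
Qed.

Lemma mem_singles n a : (a \in singles n) =
  [&& size a == 1, path geq n a & all (leq 2) a].
Proof.
apply/mapP/idP => [[x + ->]|].
  by rewrite mem_iota /=; lia.
case: a => [//|x [|//]] /and3P[_ /= h1 h2]; exists x => //.
by rewrite mem_iota; lia.
Qed.

Lemma mem_singles_goods n a : 1 < n -> (a \in singles n ++ goods n) =
  [&& a != [::], path geq n a, all (leq 2) a & prodn a + size a <= n + sumnn a].
Proof.
move=> n1; rewrite mem_cat mem_singles mem_goods.
case: a => [//|x [|y t]]; first by rewrite /= !big_seq1; lia.
set a := x :: y :: t; apply/idP/idP => [ha|].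
  have xn : x <= n.
    by apply: (@goods_head n x (y :: t)); rewrite mem_goods; case/orP: ha => // /and3P[].
  case/orP: ha => [/and3P[//]|/and4P[_ /= -> -> ->]].
  by rewrite xn.
by case/and4P=> _ /= /andP[_ ->] -> ->.
Qed.

(** A recursive call needs the strict inequality, which is the weak one for n - 1. One-entry lists
    satisfy it as soon as n > 1. *)
Lemma mem_nodes_goods n a : 1 < n -> (a \in nodes n n 1 0 0 n) =
  (a == [::]) || (a \in singles n ++ goods n.-1).
Proof.
move=> n1; rewrite mem_nodes// /strict mul1n !add0n.
case: a => [|x [|y t]].
- by rewrite /= (ltn_trans _ n1).
- by rewrite mem_cat mem_singles mem_goods /= !big_seq1; lia.
rewrite mem_cat mem_singles /=; apply/idP/idP.
  case/and4P=> _ /and3P[xn xy yt] h2 h; rewrite mem_goods.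
  by apply/and4P; split => //=; [rewrite xy yt|lia].
move=> ha; have xn := goods_head ha; move: (ha).
rewrite mem_filter => /andP[/and4P[_ /= -> -> h] hb].
have xn' : x <= n by lia.
move: hb; rewrite xn' mem_bseqs => /andP[/= hs _].
by move: h; set P := prodn _; set S := sumnn _ => h; lia.
Qed.

Definition tail_eq a : bool := if rev a is x :: y :: _ then x == y else false.

Lemma tail_eq_rcons t x : tail_eq (rcons t x) = (t != [::]) && (last x t == x).
Proof.
rewrite /tail_eq rev_rcons; case/lastP: t => [//|t y].
by rewrite rev_rcons last_rcons eq_sym; case: t.
Qed.

Lemma fits_rcons n t x : (prodn (rcons t x) + size (rcons t x) <= n + sumnn (rcons t x))
  = (prodn t * x + (size t).+1 <= sumnn t + x + n).
Proof. by rewrite -cats1 !big_cat !big_seq1 size_cat /= addn1 (addnC n). Qed.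

(** As P x >= P + x for P, x >= 2, a value that fits after t forces on t the strict inequality of a
    call. *)
Lemma rcons_node n t x : 1 < n -> path geq n t -> all (leq 2) t -> 2 <= x ->
  prodn t * x + (size t).+1 <= sumnn t + x + n -> t \in nodes n n 1 0 0 n.
Proof.
move=> n1 pt t2 x2 h.
rewrite mem_nodes_goods// mem_cat mem_singles mem_goods pt t2.
have [st|st] := leqP (size t) 1.
  by case: t st {pt t2 h} => [|y [|]].
have P2 : 2 <= prodn t.
  by apply: leq_trans (expn_size_prod t2); rewrite -[X in X <= _]expn1 leq_exp2l// ltnW.
have -> : sorted geq t by case: t pt {t2 h st P2} => [//|y t] /= /andP[].
have Px : prodn t + x <= prodn t * x by move: (prodn t) P2 => P P2; nia.
apply/orP; right; apply/orP; right; rewrite /=; move: Px h.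
by clear -n1; move: (prodn t * x) (prodn t) (sumnn t) (size t); lia.
Qed.

(** Appending a fitting value to a node is injective, and each list of [singles n ++ goods n] arises
    in this way from itself without its last entry. *)
Lemma sum_children n : 1 < n ->
  \sum_(t <- nodes n n 1 0 0 n) count (fun x => prodn t * x + (size t).+1 <=
     sumnn t + x + n) (iota 2 (last n t).-1) = n.-1 + size (goods n).
Proof.
move=> n1; pose children t := [seq x <- iota 2 (last n t).-1 |
  prodn t * x + (size t).+1 <= sumnn t + x + n].
transitivity (size [seq rcons t x | t <- nodes n n 1 0 0 n, x <- children t]).
  rewrite size_allpairs_dep sumnE big_map; apply: eq_bigr => t _.
  by rewrite size_filter.
rewrite -[n.-1](size_iota 2) -(size_map (fun x => [:: x])) -size_cat.
apply/perm_size/uniq_perm; last 2 first.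
- exact: singles_goods_uniq.
- move=> b; rewrite mem_singles_goods//; apply/allpairsPdep/idP => [[t [x []]]|].
    rewrite mem_nodes_goods// => ht; rewrite mem_filter mem_iota => /andP[h hx] ->.
    rewrite fits_rcons h andbT rcons_path all_rcons -size_eq0 size_rcons /=.
    have [-> ->] : path geq n t /\ all (leq 2) t.
      case/orP: ht => [/eqP-> //|]; rewrite mem_cat => /orP[].
        by rewrite mem_singles => /and3P[_ -> ->].
      case: t {h hx} => [//|y t] ht; have yn := goods_head ht.
      move: ht; rewrite mem_goods => /and4P[_ st -> _]; split=> //.
      by move: st => /= ->; rewrite andbT (leq_trans yn (leq_pred n)).
    by rewrite /=; lia.
  case/lastP: b => [//|t x]; rewrite fits_rcons rcons_path all_rcons.
  case/and4P=> _ /andP[pt xt] /andP[x2 t2] h.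
  exists t, x; split=> //.
    exact: rcons_node h.
  by rewrite mem_filter h mem_iota x2 /=; move: xt => /=; lia.
- apply: allpairs_uniq_dep => [|t _|[t x] [u y] _ _ /= /rcons_inj[-> ->]] //.
    exact: nodes_uniq.
  by rewrite filter_uniq// iota_uniq.
Qed.

(* A call ends with a failed comparison iff the repetition of its last entry
   fails; otherwise this repetition is a solution, with two equal last entries. *)
Lemma sum_misfits n : 1 < n ->
  \sum_(t <- nodes n n 1 0 0 n) has (predC (fun x => prodn t * x + (size t).+1 <=
     sumnn t + x + n)) (iota 2 (last n t).-1) + count tail_eq (goods n) =
  n.-1 + size (goods n.-1).
Proof.
move=> n1; pose L := singles n ++ goods n.-1.
pose fit t := prodn t * last n t + (size t).+1 <= sumnn t + last n t + n.
have permL : perm_eq (nodes n n 1 0 0 n) ([::] :: L).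
  apply: uniq_perm; first exact: nodes_uniq.
    rewrite /= singles_goods_uniq andbT mem_cat mem_singles mem_goods //.
  by move=> t; rewrite mem_nodes_goods// inE.
have hasE t : 2 <= last n t -> all (leq 2) t ->
  has (predC (fun x => prodn t * x + (size t).+1 <= sumnn t + x + n))
    (iota 2 (last n t).-1) = ~~ fit t.
  move=> l2 t2; have P1 : 0 < prodn t by apply: prod_ge1; exact: all_leq_trans t2.
  apply/hasP/idP => [[x]|h].
    rewrite mem_iota => hx; apply: contra; rewrite /fit.
    have {hx} : x <= last n t by lia.
    by move: (prodn t) P1 (last n t) (sumnn t) (size t) => P P1 l S z xl; nia.
  by exists (last n t) => //; rewrite mem_iota; lia.
have L2 t : t \in L -> [/\ t != [::], path geq n t, all (leq 2) t & 2 <= last n t].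
  move=> tL; have : t \in nodes n n 1 0 0 n by rewrite mem_nodes_goods// tL orbT.
  rewrite mem_nodes// => /and4P[_ pt t2 _].
  have t0 : t != [::].
    by apply/eqP => t0; move: tL; rewrite t0 mem_cat mem_singles mem_goods.
  split=> //; case/lastP: t t0 t2 {tL pt} => [//|t x] _.
  by rewrite all_rcons last_rcons => /andP[].
rewrite (perm_big _ permL) big_cons /= hasE//.
(* At the root the largest value n fits, because n + 1 <= 2 n, so no comparison fails there. *)
rewrite {1}/fit !big_nil /= (_ : 1 * n + 1 <= 0 + n + n)/=; last by lia.
rewrite add0n big_seq (eq_bigr (fun t => ~~ fit t : nat)); last first.
  by move=> t /L2[_ _ t2 l2]; rewrite hasE.
rewrite -big_seq.
have -> : \sum_(t <- L) (~~ fit t : nat) = count (predC fit) L.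
  by rewrite -sum1_count [RHS]big_mkcond /=; apply: eq_bigr => t _; case: (fit t).
suff -> : count tail_eq (goods n) = count fit L.
  by rewrite addnC count_predC size_cat size_map size_iota.
(* Doubling the last entry is the bijection between the calls without failure and the solutions with
   two equal last entries. *)
rewrite -!size_filter -(size_map (fun t => rcons t (last n t)) [seq t <- L | fit t]).
apply/esym/perm_size/uniq_perm.
- rewrite map_inj_in_uniq ?filter_uniq ?singles_goods_uniq//.
  by move=> t u _ _ /rcons_inj[].
- by rewrite filter_uniq// goods_uniq.
move=> b; apply/mapP/idP => [[t + ->]|].
  rewrite mem_filter => /andP[ft /L2[t0 pt t2 l2]].
  rewrite mem_filter tail_eq_rcons t0 mem_goods fits_rcons -/(fit t) ft size_rcons.
  rewrite ltnS lt0n size_eq0 t0 all_rcons l2 t2.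
  case: t t0 pt {ft t2 l2} => [//|y t] _ /= /andP[_ pt].
  by rewrite rcons_path pt /= eqxx leqnn.
rewrite mem_filter; case/lastP: b => [//|t x]; rewrite tail_eq_rcons.
case/andP=> /andP[t0 /eqP lx] hb; have lx' : last n t = x by rewrite -lx; case: t t0 {lx hb}.
exists t; last by rewrite lx'.
rewrite mem_filter /fit lx'.
have : rcons t x \in singles n ++ goods n by rewrite mem_cat hb orbT.
rewrite mem_singles_goods// fits_rcons rcons_path all_rcons.
case/and4P=> _ /andP[pt xt] /andP[x2 t2] h; rewrite h /=.
by have := rcons_node n1 pt t2 x2 h; rewrite mem_nodes_goods// (negbTE t0).
Qed.

Lemma Theta_goods n : 1 < n -> Theta n + count tail_eq (goods n) =
  (n.-1 + size (goods n)) + (n.-1 + size (goods n.-1)).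
Proof.
move=> n1; rewrite -(sum_children n1) -(sum_misfits n1) addnA -big_split /=.
congr (_ + _); rewrite /Theta /run searchE//=; apply: eq_bigr => t _.
by rewrite /comparisons mul1n !add0n.
Qed.

End Goods.

(** * Solutions as padded lists *)

Section Solutions.
Local Open Scope nat_scope.
Implicit Types (n x : nat) (a b t : seq nat).

Lemma sum_le_prod a : a != [::] -> all (leq 2) a -> sumnn a <= prodn a.
Proof.
elim: a => [//|x [|y t] IH] _ /= /andP[x2 t2]; first by rewrite !big_seq1.
have := IH isT t2; have := expn_size_prod (t2 : all (leq 2) (y :: t)).
rewrite !(big_cons _ _ x) /= expnS; have := expn_gt0 2 (size t).
by move: (2 ^ size t) (\prod_(j <- _) j) (\sum_(j <- _) j) => k P S /=; nia.
Qed.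

Lemma prodn_nseq1 k : prodn (nseq k 1) = 1.
Proof. by rewrite big_nseq; elim: k => //= k ->. Qed.

Lemma sumnn_nseq1 k : sumnn (nseq k 1) = k.
Proof. by rewrite big_nseq; elim: k => //= k ->. Qed.

(** Ones raise the sum but not the product, so their number is forced; by [sum_le_prod] the
    truncated subtraction is exact for nonempty lists of entries >= 2. *)
Definition pad b := b ++ nseq (prodn b - sumnn b) 1.

Lemma filter_pad b : all (leq 2) b -> seq.filter (leq 2) (pad b) = b.
Proof. by move=> /all_filterP; rewrite filter_cat filter_nseq /= cats0. Qed.

Lemma sorted_ones a : sorted geq a -> all (leq 1) a ->
  a = seq.filter (leq 2) a ++ nseq (count_mem 1 a) 1.
Proof.
elim: a => [//|x a IH] /= sa /andP[x1 a1].
have h := IH (path_sorted sa) a1.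
have [x2|x2] := leqP 2 x; first by rewrite (_ : x == 1 = false) ?add0n /= -?h//; lia.
have -> : x = 1 by lia.
rewrite eqxx /= (_ : seq.filter _ a = [::]) /=.
  rewrite {1}h (_ : seq.filter _ a = [::])//.
  apply/eqP; rewrite -[_ == _]negbK -has_filter; apply/hasPn => y ya.
  by have := allP (order_path_min geq_trans sa) y ya => /=; lia.
apply/eqP; rewrite -[_ == _]negbK -has_filter; apply/hasPn => y ya.
by have := allP (order_path_min geq_trans sa) y ya => /=; lia.
Qed.

(** Erasing the ones inverts [pad], and the padded list has length size b + prod b - sum b, whence
    the inequality in [goods]. *)
Lemma nb_solutions_goods n : nb_solutions_le n = size (goods n).
Proof.
rewrite /nb_solutions_le -(size_map pad); apply/perm_size/uniq_perm.
- exact: fset_uniq.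
- rewrite map_inj_in_uniq ?goods_uniq// => a b.
  rewrite !mem_goods => /and4P[_ _ a2 _] /and4P[_ _ b2 _] h.
  by rewrite -(filter_pad a2) h filter_pad.
move=> a; rewrite in_solutions_le; apply/idP/mapP => [|[b + ->]].
  case/andP=> /andP[s2 sn] /and3P[sa a1 /eqP ha].
  have [b [sb b2 ea]] : exists b, [/\ sorted geq b, all (leq 2) b &
      a = b ++ nseq (count_mem 1 a) 1].
    exists (seq.filter (leq 2) a); split; [|exact: filter_all|exact: sorted_ones].
    exact: (sorted_filter geq_trans).
  move: (count_mem 1 a) ea => k ea.
  have hP : prodn a = prodn b by rewrite ea big_cat /= prodn_nseq1 muln1.
  have hS : sumnn a = sumnn b + k by rewrite ea big_cat /= sumnn_nseq1.
  have hz : size a = size b + k by rewrite ea size_cat size_nseq.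
  have kE : prodn b - sumnn b = k by rewrite -hP ha hS addKn.
  exists b; last by rewrite /pad kE ea.
  rewrite hP hS in ha; rewrite mem_goods b2 sb ha /=.
  apply/andP; split; last by rewrite -addnA [k + _]addnC -hz addnC leq_add2r.
  (* With at most one entry >= 2, the solution would have length 1. *)
  case: b {sb b2 ea hS} hP hz ha {kE} => [|x [|y t]] //; rewrite ?big_nil ?big_seq1 /=; lia.
rewrite mem_goods => /and4P[sb so b2 hb].
have b1 := all_leq_trans (isT : 1 <= 2) b2.
have le : sumnn b <= prodn b by apply: sum_le_prod => //; case: (b) sb.
rewrite /is_solution /pad size_cat size_nseq !big_cat /= prodn_nseq1 sumnn_nseq1.
rewrite all_cat b1 all_nseq orbT muln1 subnKC// eqxx !andbT.
apply/andP; split.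
  by move: sb hb le; move: (prodn b) (sumnn b) (size b) => P S z; clear; lia.
rewrite (sorted_pairwise geq_trans) pairwise_cat -!(sorted_pairwise geq_trans) so /=.
apply/andP; split.
  apply/allrelP => x y xb /nseqP[-> _]; exact: (allP b1).
by elim: (prodn b - _) => // -[|k] //= ->.
Qed.

End Solutions.

(** * Counting solutions by multiplicative partitions *)

Section Counting.
Local Open Scope nat_scope.
Implicit Types (n d k x D r : nat) (a b t : seq nat).

Lemma leq_goods n : size (goods n.-1) <= size (goods n).
Proof.
apply: uniq_leq_size; first exact: goods_uniq.
move=> a; rewrite !mem_goods => /and4P[-> -> -> h] /=.
by apply: leq_trans h _; rewrite leq_add2r leq_pred.
Qed.

(** Witnessed by the pairs (x, 2) with 2 <= x <= n. It absorbs the terms n - 1 of [Theta_goods]. *)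
Lemma pred_leq_goods n : n.-1 <= size (goods n).
Proof.
rewrite -[n.-1](size_iota 2) -(size_map (fun x => [:: x; 2])).
apply: uniq_leq_size; first by rewrite map_inj_uniq ?iota_uniq// => x y [].
move=> _ /mapP[x + ->]; rewrite mem_iota mem_goods /= !big_cons !big_nil; lia.
Qed.

Lemma leq_size_sum a : all (leq 1) a -> size a <= sumnn a.
Proof.
elim: a => [|x a IH] /=; first by rewrite big_nil.
by case/andP=> x1 /IH; rewrite big_cons -add1n; exact: leq_add.
Qed.

Lemma mparts_goods n a : 1 < size a -> a \in mparts 2 n -> a \in goods n.
Proof.
move=> s2; rewrite mem_mparts// mem_goods s2 => /and3P[-> a2 an]; rewrite a2 /=.
by rewrite leq_add// leq_size_sum//; exact: all_leq_trans a2.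
Qed.

Lemma size_mparts_goods n : 0 < n ->
  size (mparts 2 n) <= count (fun a => prodn a <= n) (goods n) + n.
Proof.
move=> n0; rewrite -size_filter.
have e : size ([::] :: singles n) = n by rewrite /= size_map size_iota prednK.
rewrite -[X in _ + X]e -size_cat; apply: uniq_leq_size; first exact: mparts_uniq.
move=> a am; rewrite mem_cat mem_filter inE mem_singles.
have := am; rewrite mem_mparts// => /and3P[_ a2 an].
have [s1|s1] := leqP (size a) 1; last by rewrite an (mparts_goods s1 am).
apply/orP; right; case: a a2 an s1 {am} => [//|x [|//]] /= /andP[x2 _].
by rewrite big_seq1 x2 => ->.
Qed.

Lemma count_tail_mparts n :
  count tail_eq (mparts 2 n) <= count tail_eq (goods n).
Proof.
rewrite -!size_filter; apply: uniq_leq_size; first by rewrite filter_uniq// mparts_uniq.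
move=> a; rewrite (mem_filter _ _ (mparts 2 n)) => /andP[ha am].
rewrite mem_filter ha mparts_goods//.
by case: a ha {am} => [|x [|]].
Qed.

Lemma count_predID (T : Type) (P Q : pred T) (s : seq T) :
  count P s = count (predI P Q) s + count (predI P (predC Q)) s.
Proof. by elim: s => //= x s ->; case: (P x); case: (Q x) => /=; lia. Qed.

(** The lists of [goods n] with product above n number at most size (goods n) - size (mparts 2 n) +
    n, which turns out to be o(A(n)); all of them may be counted as having equal last entries. *)
Lemma count_tail_goods n : 0 < n ->
  count tail_eq (goods n) + size (mparts 2 n) <=
  count tail_eq (mparts 2 n) + size (goods n) + n.
Proof.
move=> n0; have := size_mparts_goods n0.
rewrite -(count_predC (fun a => prodn a <= n) (goods n)).
rewrite (count_predID tail_eq (fun a => prodn a <= n) (goods n)).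
have h1 : count (predI tail_eq (fun a => prodn a <= n)) (goods n) <=
    count tail_eq (mparts 2 n).
  rewrite -!size_filter; apply: uniq_leq_size; first by rewrite filter_uniq// goods_uniq.
  move=> a; rewrite (mem_filter _ _ (goods n)) mem_goods.
  move=> /andP[/andP[ha an] /and4P[_ sa a2 _]].
  by rewrite mem_filter ha mem_mparts// sa a2.
have h2 : count (predI tail_eq (predC (fun a => prodn a <= n))) (goods n) <=
    count (predC (fun a => prodn a <= n)) (goods n).
  by apply: sub_count => a /andP[].
lia.
Qed.

Lemma sqr_le_exp2 k : 3 < k -> k ^ 2 <= 2 ^ k.
Proof.
elim: k => // k IH; rewrite ltnS leq_eqVlt => /predU1P[<- //|k3].
by have := IH k3; rewrite expnS [2 ^ k.+1]expnS -!mulnn; nia.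
Qed.

(* If the sum is not small compared to the product, then either all entries but
   the first have bounded product, or all entries are bounded. *)
Lemma size_goods_le r : 0 < r -> exists C, forall n, 0 < n ->
  size (goods n) <= size (mparts 2 (n + n %/ r)) + C * n.
Proof.
(* If q (sum - size) <= prod, then (q - 1) prod <= q n, so q = r + 1 gives prod <= n + n / r. If all
   entries are at most 2 q and this fails, then k^2 <= 2^k <= prod < 2 q^2 k for a length k >= 4,
   which [k0] excludes. *)
move=> r0; pose q := r.+1; pose k0 := 4 + 2 * q ^ 2.
exists (size (mparts 2 (2 * q)) + size (mparts 2 ((2 * q) ^ k0))) => n n0.
pose L2 := [seq x :: t | x <- iota 1 n, t <- mparts 2 (2 * q)].
apply: (@leq_trans (size (mparts 2 (n + n %/ r) ++ (L2 ++ mparts 2 ((2 * q) ^ k0))))); last first.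
  rewrite !size_cat size_allpairs size_iota leq_add2l mulnDl leq_add//.
    by rewrite mulnC.
  by rewrite leq_pmulr.
apply: uniq_leq_size; first exact: goods_uniq.
move=> a ag; rewrite !mem_cat; have := ag; rewrite mem_goods => /and4P[sz sa a2 ha].
have [h|h] := leqP (q * sumnn a) (prodn a + q * size a).
  apply/orP; left; rewrite mem_mparts// sa a2 /=.
  rewrite -leq_subLR leq_divRL// mulnBl.
  move: h ha; rewrite /q; move: (prodn a) (sumnn a) (size a) => P S k; clear; nia.
apply/orP; right; case: a ag sz sa a2 ha h => [//|x t] ag sz sa a2 ha h.
have xn := goods_head ag.
have t2 : all (leq 2) t by case/andP: a2.
have x2 : 1 < x by case/andP: a2.
have [Q|Q] := leqP (prodn t) (2 * q).
  apply/orP; left; apply/allpairsP; exists (x, t); split => //=.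
    by rewrite mem_iota; lia.
  by rewrite mem_mparts// t2 Q !andbT (path_sorted sa).
apply/orP; right; rewrite mem_mparts// sa a2 /=.
have xq : x <= 2 * q.
  have := sum_lt_prod_size (all_leq_trans (isT : 1 <= 2) t2).
  move: h Q; rewrite !big_cons /=; move: (prodn t) (sumnn t) (size t) => P S z.
  rewrite ltnNge => + QP hS; apply: contraR; rewrite -ltnNge => xq.
  (* Both x and P exceed 2 q, so each half of x P dominates one of the two terms. *)
  have e1 : q * P + q * x <= x * P by nia.
  nia.
have aq : all (fun y => y <= 2 * q) (x :: t).
  rewrite /= xq; apply/allP => y yt; apply: leq_trans xq.
  exact: (allP (order_path_min geq_trans sa) y yt).
have bnd b : all (fun y => y <= 2 * q) b ->
    sumnn b <= 2 * q * size b /\ prodn b <= (2 * q) ^ size b.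
  elim: b => [|y b IH] /=; first by rewrite !big_nil muln0.
  case/andP=> yq /IH[h1 h2]; rewrite !big_cons mulnS expnS.
  by split; [exact: leq_add|exact: leq_mul].
have [hS hP] := bnd _ aq; apply: leq_trans hP _.
have q1 : 1 < 2 * q by rewrite /q; lia.
rewrite leq_exp2l// leqNgt; apply/negP => hk.
have := expn_size_prod a2; have := sqr_le_exp2 (ltn_trans (leq_addr _ 4 : 3 < k0) hk).
have uS : q * sumnn (x :: t) <= q * (2 * q * size (x :: t)) by rewrite leq_mul.
move=> k2 eP; have : size (x :: t) ^ 2 < q * (2 * q * size (x :: t)).
  apply: leq_trans uS; apply: leq_ltn_trans h; apply: leq_trans k2 _.
  exact: leq_trans eP (leq_addr _ _).
rewrite (_ : q * (2 * q * size (x :: t)) = 2 * q ^ 2 * size (x :: t)); last by lia.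
rewrite -mulnn ltn_mul2r => /andP[_]; apply/negP; rewrite -leqNgt.
exact: leq_trans (leq_addl 4 _) (ltnW hk).
Qed.

(** Either d is not a part, or one copy of it can be removed. *)
Lemma size_mpartsS d n : 2 <= d ->
  size (mparts d n) = size (mparts d.+1 n) + size (mparts d (n %/ d)).
Proof.
move=> d2; rewrite -(count_predC (fun a => 1 <= count_mem d a)) addnC; congr (_ + _).
  rewrite -size_filter; apply/perm_size/uniq_perm.
  - by rewrite filter_uniq// mparts_uniq.
  - exact: mparts_uniq.
  move=> a; rewrite (mem_filter _ _ (mparts d n)) !mem_mparts//=; last exact: leqW.
  rewrite andbCA; congr (_ && _); rewrite andbA; congr (_ && _).
  rewrite -eqn0Ngt -leqn0 leqNgt -has_count has_pred1.
  elim: a => //= x a <-; rewrite inE negb_or andbACA; congr (_ && _).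
  by rewrite [RHS]ltn_neqAle.
rewrite -size_filter (perm_size (insert_parts_perm 1 n (d := d) (k := d) _)) ?d2 ?leqnn//.
rewrite size_map; apply/perm_size/uniq_perm.
- by rewrite filter_uniq// mparts_uniq.
- exact: mparts_uniq.
move=> a; rewrite (mem_filter _ _ (mparts d n)) !mem_mparts// expn1 leq_divRL; last exact: ltnW.
apply/idP/idP => [/andP[h /and3P[-> -> _]]|/and3P[-> -> h]]; rewrite h//=.
by apply: leq_trans h; rewrite leq_pmulr//; exact: ltnW.
Qed.

Lemma count_tail_last d n : 2 <= d ->
  count (fun a => tail_eq a && (last 0 a == d)) (mparts 2 n) =
  size (mparts d (n %/ d ^ 2)).
Proof.
move=> d2; rewrite -size_filter -(size_map (fun a => rcons (rcons a d) d) (mparts d _)).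
apply/perm_size/uniq_perm; first by rewrite filter_uniq// mparts_uniq.
  by rewrite map_inj_uniq ?mparts_uniq// => a b /rcons_inj[] /rcons_inj[].
move=> b; rewrite (mem_filter _ _ (mparts 2 n)); apply/idP/mapP => [|[a + ->]].
  case/andP=> /andP[ht /eqP hl]; rewrite mem_mparts//.
  case/lastP: b ht hl => [//|b x]; rewrite tail_eq_rcons last_rcons => /andP[b0 + xd].
  rewrite {}xd {x}; case/lastP: b b0 => [//|a x] _; rewrite last_rcons => /eqP-> {x}.
  case/and3P=> sa a2 an; exists a => //.
  have hP : prodn (rcons (rcons a d) d) = prodn a * d ^ 2.
    by rewrite -!cats1 !big_cat !big_seq1 /= -mulnA.
  rewrite mem_mparts// leq_divRL ?expn_gt0 ?(ltnW d2)// -hP an andbT.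
  move: sa; rewrite (sorted_pairwise geq_trans) -!cats1 !pairwise_cat.
  rewrite -!(sorted_pairwise geq_trans) => /and3P[_ /and3P[+ -> _] _] /=.
  by rewrite allrel1r.
rewrite mem_mparts// leq_divRL ?expn_gt0 ?(ltnW d2)// => /and3P[sa ad an].
rewrite tail_eq_rcons !last_rcons !eqxx -size_eq0 size_rcons /= mem_mparts//.
have -> : prodn (rcons (rcons a d) d) = prodn a * d ^ 2.
  by rewrite -!cats1 !big_cat !big_seq1 /= -mulnA.
rewrite an !all_rcons d2 (all_leq_trans d2 ad) !andbT.
rewrite (sorted_pairwise geq_trans) -!cats1 !pairwise_cat -!(sorted_pairwise geq_trans).
by rewrite sa /= !allrel1r all_cat ad /= leqnn !andbT.
Qed.

Lemma count_tail_split D n : count tail_eq (mparts 2 n) =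
  \sum_(2 <= d < D.+1) size (mparts d (n %/ d ^ 2)) +
  count (fun a => tail_eq a && (D < last 0 a)) (mparts 2 n).
Proof.
have -> : \sum_(2 <= d < D.+1) size (mparts d (n %/ d ^ 2)) =
    count (fun a => tail_eq a && (last 0 a <= D)) (mparts 2 n).
  elim: D => [|D IH].
    rewrite big_geq//; apply/esym/eqP; rewrite -leqn0 leqNgt -has_count.
    apply/hasPn => a; rewrite mem_mparts// => /and3P[_ + _].
    case/lastP: a => [//|a x]; rewrite all_rcons last_rcons => /andP[x2 _].
    by rewrite negb_and -ltnNge; apply/orP; right; exact: ltnW.
  have [D1|D1] := leqP 1 D; last first.
    rewrite big_geq//; apply/esym/eqP; rewrite -leqn0 leqNgt -has_count.
    apply/hasPn => a; rewrite mem_mparts// => /and3P[_ + _].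
    case/lastP: a => [//|a x]; rewrite all_rcons last_rcons => /andP[x2 _].
    by rewrite negb_and -ltnNge; apply/orP; right; apply: leq_trans x2.
  rewrite big_nat_recr//= IH -count_tail_last// -!sum1_count.
  rewrite [in LHS]big_mkcond [X in _ + X]big_mkcond -big_split /= [RHS]big_mkcond /=.
  apply: eq_bigr => a _; case: tail_eq => //=.
  by case: (leqP (last 0 a) D); case: (leqP (last 0 a) D.+1); case: eqP => //=; lia.
rewrite -!sum1_count [LHS]big_mkcond [X in _ = X + _]big_mkcond.
rewrite [X in _ = _ + X]big_mkcond -big_split /=.
by apply: eq_bigr => a _; case: tail_eq => //=; case: leqP.
Qed.

(* The smallest part may be lowered to any [j], [2 <= j <= D + 1]. *)
Lemma count_tail_large D n :
  D * count (fun a => tail_eq a && (D < last 0 a)) (mparts 2 n) <= size (mparts 2 n).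
Proof.
rewrite -size_filter -{1}(size_iota 2 D) mulnC.
set L := [seq a <- _ | _].
have Lp a : a \in L -> exists b x, [/\ a = rcons (rcons b x) x, D < x & a \in mparts 2 n].
  rewrite (mem_filter _ _ (mparts 2 n)) => /andP[/andP[]]; case/lastP: a => [//|b x].
  rewrite tail_eq_rcons last_rcons => /andP[b0 /eqP hl] Dx h.
  case/lastP: b b0 hl h => [//|b y] _; rewrite last_rcons => -> h.
  by exists b, x.
have trunc b (x y : nat) : take (size (rcons b x)) (rcons (rcons b x) y) = rcons b x.
  by rewrite -[rcons (rcons b x) y]cats1 take_size_cat.
(* The other copy of the smallest part stays, so the original list can be recovered and lowering is
   injective. *)
pose low a j := rcons (take (size a).-1 a) j.
have lowE b (x y j : nat) : low (rcons (rcons b x) y) j = rcons (rcons b x) j.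
  by rewrite /low size_rcons trunc.
rewrite -(size_allpairs low); apply: uniq_leq_size.
  apply: allpairs_uniq; [|exact: iota_uniq|].
    by rewrite filter_uniq// mparts_uniq.
  move=> [a j] [b k] /allpairsP[[a1 j1] [/= /Lp[u [x [-> _ _]]] _ [-> ->]]].
  move=> /allpairsP[[b1 k1] [/= /Lp[v [y [-> _ _]]] _ [-> ->]]] /=.
  by rewrite !lowE => /rcons_inj[/rcons_inj[-> ->] ->].
move=> _ /allpairsP[[a j] [/= /Lp[b [x [-> Dx +]]] + ->]].
rewrite lowE mem_iota !mem_mparts// !all_rcons => + /andP[j2 jD].
have jx : j <= x by lia.
move=> /and3P[sa /and3P[_ x2 b2] an]; rewrite j2 x2 b2 /=.
apply/andP; split; last first.
  by apply: leq_trans an; rewrite -!cats1 !big_cat !big_seq1 leq_mul2l jx orbT.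
move: sa; rewrite !(sorted_pairwise geq_trans) -!cats1 !pairwise_cat /= !andbT.
case/and3P=> h1 h2 ->; rewrite h2 andbT; move: h1; rewrite !allrel1r.
by rewrite andbT; apply: sub_all => z /= xz; exact: leq_trans xz.
Qed.

End Counting.

(** * Liouville-Green asymptotics *)

Section Derivatives.
Variable R : realType.
Implicit Types (f g : R -> R) (x a b : R).

Lemma ider_eq f x d e : is_derive x 1 f d -> d = e -> is_derive x 1 f e.
Proof. by move=> + <-. Qed.

Lemma ider_cst x a : is_derive x 1 (fun=> a) 0.
Proof. exact: is_derive_cst. Qed.

Lemma ider_id x : is_derive x 1 (fun y : R => y) 1.
Proof. exact: is_derive_id. Qed.

Lemma iderD f g x df dg : is_derive x 1 f df -> is_derive x 1 g dg ->
  is_derive x 1 (fun y => f y + g y) (df + dg).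
Proof. by move=> hf hg; exact: is_deriveD. Qed.

Lemma iderN f x df : is_derive x 1 f df -> is_derive x 1 (fun y => - f y) (- df).
Proof. by move=> hf; exact: is_deriveN. Qed.

Lemma iderM f g x df dg : is_derive x 1 f df -> is_derive x 1 g dg ->
  is_derive x 1 (fun y => f y * g y) (f x * dg + g x * df).
Proof. by move=> hf hg; exact: is_deriveM. Qed.

Lemma iderV f x df : f x != 0 -> is_derive x 1 f df ->
  is_derive x 1 (fun y => (f y)^-1) (- (f x)^-2 * df).
Proof. by move=> fx0 hf; exact: is_deriveV. Qed.

Lemma ider_exp f x df : is_derive x 1 f df ->
  is_derive x 1 (fun y => expR (f y)) (expR (f x) * df).
Proof. by move=> hf; apply: (@is_derive1_comp _ expR f). Qed.

Lemma ider_ln x : 0 < x -> is_derive x 1 (@ln R) x^-1.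
Proof. exact: is_derive1_ln. Qed.

Lemma ider_le f (df : R -> R) a b : a <= b ->
  (forall x, a <= x <= b -> is_derive x 1 f (df x)) ->
  (forall x, a <= x <= b -> 0 <= df x) -> f a <= f b.
Proof.
move=> ab hf df0.
have [||c cab h] := @MVT_segment R f df a b ab.
- by move=> x xab; apply: hf; rewrite !ltW ?(itvP xab).
- apply: derivable_within_continuous => x xab.
  by case: (hf x); rewrite ?(itvP xab).
rewrite -subr_ge0 h mulr_ge0 ?subr_ge0//.
by apply: df0; rewrite !(itvP cab).
Qed.

End Derivatives.

Section LiouvilleGreen.
Variable R : realType.
Implicit Types (K x : R).

(* In the variable [v = x ^+ 2], [phi K] solves [y'' = y / v] up to an error that
   has the sign of [K] when [K] and [v / K] are large; [phi_log K] is its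
   logarithmic derivative in [v]. *)
Definition phi K x : R := expR (ln x / 2 + 2 * x - 2 * K / x).

Definition phi_log K x : R := x^-1 + (4 * x ^+ 2)^-1 + K / x ^+ 3.

Lemma phi_gt0 K x : 0 < phi K x. Proof. exact: expR_gt0. Qed.

Lemma ider_inv x : 0 < x -> is_derive x 1 (fun y : R => y^-1) (- x^-2 * 1).
Proof.
by move=> x0; exact: (@iderV _ (fun y => y) x 1 (lt0r_neq0 x0) (ider_id x)).
Qed.

Lemma ider_phi K x : 0 < x ->
  is_derive x 1 (phi K) (phi K x * (2 * x * phi_log K x)).
Proof.
move=> x0; have xn0 : x != 0 by rewrite gt_eqF.
have h := ider_exp (iderD (iderD (iderM (ider_ln x0) (ider_cst x 2^-1))
  (iderM (ider_cst x 2) (ider_id x)))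
  (iderN (iderM (ider_cst x (2 * K)) (ider_inv x0)))).
by apply: (ider_eq h); rewrite /phi_log /phi /=; congr (_ * _); field.
Qed.

Lemma ider_phi_log K x : 0 < x ->
  is_derive x 1 (phi_log K) (- x ^- 2 - (2 * x ^+ 3)^-1 - 3 * K / x ^+ 4).
Proof.
move=> x0; have xn0 : x != 0 by rewrite gt_eqF.
have -> : phi_log K =
    fun y => y^-1 + 4^-1 * (y^-1 * y^-1) + K * (y^-1 * (y^-1 * y^-1)).
  by apply/funext => y; rewrite /phi_log !exprS expr0 !mulr1 !invfM.
have hV := ider_inv x0; have h2 := iderM hV hV.
have h := iderD (iderD hV (iderM (ider_cst x 4^-1) h2))
  (iderM (ider_cst x K) (iderM hV h2)).
by apply: (ider_eq h); field.
Qed.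

(* The last factor is [2 * x] times [phi'' / phi], derivatives being in [v]. *)
Lemma ider_wronskian K (p g M : R -> R) x : 0 < x ->
  is_derive x 1 p (2 * x * g x) -> is_derive x 1 g (2 * x * M x) ->
  is_derive x 1 (fun y => phi K y * (g y - phi_log K y * p y))
    (phi K x * (2 * x * M x - p x *
       (2 / x + (4 * K - 3 / 8) / x ^+ 3 - 2 * K / x ^+ 4 + 2 * K ^+ 2 / x ^+ 5))).
Proof.
move=> x0 dp dg; have xn0 : x != 0 by rewrite gt_eqF.
have h := iderM (ider_phi K x0) (iderD dg (iderN (iderM (ider_phi_log K x0) dp))).
by apply: (ider_eq h); rewrite /phi_log; field.
Qed.

(** In v, the derivative of p / phi is the Wronskian over phi^2; 2 x is dv/dx. *)
Lemma ider_ratio K (p g : R -> R) x : 0 < x ->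
  is_derive x 1 p (2 * x * g x) ->
  is_derive x 1 (fun y => p y / phi K y)
    (2 * x / phi K x ^+ 2 * (phi K x * (g x - phi_log K x * p x))).
Proof.
move=> x0 dp; have xn0 : x != 0 by rewrite gt_eqF.
have pn0 : phi K x != 0 by rewrite gt_eqF ?phi_gt0.
have h := iderM dp (iderV pn0 (ider_phi K x0)).
by apply: (ider_eq h); field; rewrite pn0.
Qed.

End LiouvilleGreen.

Section EventuallyMonotone.
Variable R : realType.
Implicit Types u : nat -> R.

Lemma nonincr_from u N0 : (forall N, (N0 <= N)%N -> u N.+1 <= u N) ->
  forall m n, (N0 <= m <= n)%N -> u n <= u m.
Proof.
move=> h m n /andP[N0m]; elim: n => [|n IH]; first by rewrite leqn0 => /eqP->.
rewrite leq_eqVlt => /predU1P[-> //|mn].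
exact: le_trans (h _ (leq_trans N0m mn)) (IH mn).
Qed.

Lemma nonincr_from_cvg u N0 (b : R) : (forall N, (N0 <= N)%N -> u N.+1 <= u N) ->
  (forall N, (N0 <= N)%N -> b <= u N) -> cvgn u.
Proof.
move=> h hb; apply: (@near_nonincreasing_is_cvgn _ _ b).
  exists N0 => // k /= N0k m km.
  by apply: (nonincr_from h); rewrite N0k.
by exists N0 => // k /= /hb.
Qed.

Lemma near_eq_cvgn u v (l : R) : v @ \oo --> l ->
  (\forall n \near \oo, u n = v n) -> u @ \oo --> l.
Proof.
move=> vl uv; apply: cvg_trans vl; apply: near_eq_cvg.
by apply: filterS uv => n; exact: esym.
Qed.

End EventuallyMonotone.

Section PhiBounds.
Variable R : realType.
Implicit Types K x : R.

(** From e^(2x) >= (2x)^3 / 3!. The cube offsets the factor x^-3 in the derivative of the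
    Wronskian. *)
Lemma cube_le_phi K x : 0 <= K -> 1 <= x -> x ^+ 3 <= phi (- K) x.
Proof.
move=> K0 x1; have x0 : 0 < x by lra.
apply: (@le_trans _ _ (expR (2 * x))); last first.
  rewrite /phi ler_expR mulrN mulNr opprK.
  have : 0 <= 2 * K / x by rewrite divr_ge0 ?mulr_ge0 ?(ltW x0).
  by have := ln_ge0 x1; lra.
have := @expR_ge1Dxn R (2 * x) 2 ltac:(lra).
have -> : 3`!%:R = 6 :> R by [].
rewrite exprMn; set y := x ^+ 3 => h.
have y0 : 0 <= y by rewrite exprn_ge0 // ltW.
by move: h; set e := expR _ => h; lra.
Qed.

(** The weight of the Wronskian in [ider_ratio] is integrable, so an upper bound on the Wronskian
    limits the total increase of the ratio. *)
Lemma invphi2_le K x : 0 <= K -> 1 <= x ->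
  2 * x / phi K x ^+ 2 <= 2 * expR (4 * K) * expR (- (4 * x)).
Proof.
move=> K0 x1; have x0 : 0 < x by lra.
have -> : phi K x ^+ 2 = x * expR (4 * x - 4 * K / x).
  rewrite -[x in x * _](lnK x0) /phi -expRM_natl -expRD; congr expR.
  by field; rewrite gt_eqF.
have -> : 2 * x / (x * expR (4 * x - 4 * K / x)) = 2 * expR (- (4 * x - 4 * K / x)).
  by rewrite expRN; field; rewrite gt_eqF ?expR_gt0// gt_eqF.
rewrite -[leRHS]mulrA -expRD ler_pM2l// ler_expR opprB lerB// ler_pdivrMr// ler_peMr//.
by rewrite mulr_ge0.
Qed.

End PhiBounds.

Section Asymptotics.
Variable R : realType.
(** On [w N, w (N + 1)] the unknown is p N, and g N, M N are its first two derivatives in v = x^2.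
    Wronskians involve p and g alone, so gluing these two makes them continuous although M may
    jump. *)
Variables (w : nat -> R) (p g M : nat -> R -> R) (C : R) (N0 : nat).
Hypothesis C0 : 0 <= C.
Hypothesis w2 : forall N, (N0 <= N)%N -> 2 <= w N.
Hypothesis ww : forall N, w N <= w N.+1.
Hypothesis woo : w @ \oo --> +oo.
Hypothesis dp : forall (N : nat) (x : R), 0 < x -> is_derive x 1 (p N) (2 * x * g N x).
Hypothesis dg : forall (N : nat) (x : R), 0 < x -> is_derive x 1 (g N) (2 * x * M N x).
Hypothesis glue_p : forall N : nat, p N (w N.+1) = p N.+1 (w N.+1).
Hypothesis glue_g : forall N, g N (w N.+1) = g N.+1 (w N.+1).
Hypothesis p_ge1 : forall (N : nat) (x : R), (N0 <= N)%N -> w N <= x <= w N.+1 -> 1 <= p N x.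
Hypothesis ode : forall (N : nat) (x : R), (N0 <= N)%N -> w N <= x <= w N.+1 ->
  `|x ^+ 2 * M N x - p N x| <= C * p N x / x ^+ 2.

(** At order x^-3 the comparison functions contribute 4 K - 3/8 and -(4 K + 3/8), to be weighed
    against 2 C from [ode]. The excess of K over C also pays for the 2 / x^3 spent in [W_grow]. *)
Let K := C + 1.

Let K1 : 1 <= K. Proof. by rewrite /K lerDr. Qed.

Let K_ge0 : 0 <= K. Proof. exact: le_trans ler01 K1. Qed.

Let W (k : R) (N : nat) (x : R) := phi k x * (g N x - phi_log k x * p N x).

Let x2 (N : nat) (x : R) : (N0 <= N)%N -> w N <= x <= w N.+1 -> 2 <= x.
Proof. by move=> /w2 h /andP[/(le_trans h)]. Qed.

Let W_glue k N : W k N (w N.+1) = W k N.+1 (w N.+1).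
Proof. by rewrite /W glue_p glue_g. Qed.

Let odeM (N : nat) (x : R) : (N0 <= N)%N -> w N <= x <= w N.+1 ->
  p N x * (2 / x - 2 * C / x ^+ 3) <= 2 * x * M N x <=
  p N x * (2 / x + 2 * C / x ^+ 3).
Proof.
move=> hN hx; have := ode hN hx; rewrite ler_norml => /andP[h1 h2].
have x0 : 0 < x by have := x2 hN hx; lra.
have xn0 : x != 0 by rewrite gt_eqF.
have t0 : 0 < 2 / x by rewrite divr_gt0.
have -> : 2 * x * M N x = 2 / x * (x ^+ 2 * M N x) by field.
have -> : p N x * (2 / x - 2 * C / x ^+ 3)
    = 2 / x * (p N x - C * p N x / x ^+ 2) by field.
have -> : p N x * (2 / x + 2 * C / x ^+ 3)
    = 2 / x * (p N x + C * p N x / x ^+ 2) by field.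
by rewrite !ler_pM2l//; apply/andP; split; lra.
Qed.

Let W_nonincr (N : nat) (x y : R) : (N0 <= N)%N -> w N <= x -> x <= y -> y <= w N.+1 ->
  W K N y <= W K N x.
Proof.
move=> hN wx xy yw; rewrite -lerN2.
apply: (ider_le (f := fun z => - W K N z) (df := fun z => - (phi K z *
  (2 * z * M N z - p N z * (2 / z + (4 * K - 3 / 8) / z ^+ 3
    - 2 * K / z ^+ 4 + 2 * K ^+ 2 / z ^+ 5)))) xy) => z /andP[xz zy].
  have hz : w N <= z <= w N.+1 by rewrite (le_trans wx xz) (le_trans zy yw).
  have z0 : 0 < z by have := x2 hN hz; lra.
  by apply: iderN; apply: ider_wronskian => //; [exact: dp|exact: dg].
have hz : w N <= z <= w N.+1 by rewrite (le_trans wx xz) (le_trans zy yw).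
have z2 := x2 hN hz; have z0 : 0 < z by lra.
rewrite -mulrN mulr_ge0 ?(ltW (phi_gt0 _ _))// opprB subr_ge0.
have /andP[_ h] := odeM hN hz; apply: le_trans h _.
rewrite ler_pM2l; last by have := p_ge1 hN hz; lra.
rewrite -subr_ge0.
have -> : 2 / z + (4 * K - 3 / 8) / z ^+ 3 - 2 * K / z ^+ 4 + 2 * K ^+ 2 / z ^+ 5
   - (2 / z + 2 * C / z ^+ 3) =
   ((4 * K - 3 / 8 - 2 * C) * z ^+ 2 - 2 * K * z + 2 * K ^+ 2) / z ^+ 5.
  by field; rewrite gt_eqF.
rewrite divr_ge0 ?exprn_ge0 ?(ltW z0)// /K.
have : 0 <= C * z by rewrite mulr_ge0 // ltW.
have : 0 <= C * z * (z - 2) by rewrite !mulr_ge0 ?subr_ge0// ltW.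
by have := sqr_ge0 (C + 1); nra.
Qed.

(** The slope of the Wronskian is at least x^3 (2 / x^3) = 2. Its initial sign being unknown,
    monotonicity would not be enough: linear growth makes it eventually nonnegative. *)
Let W_grow (N : nat) (x y : R) : (N0 <= N)%N -> 2 * K <= w N ^+ 2 -> w N <= x -> x <= y ->
  y <= w N.+1 -> W (- K) N x - 2 * x <= W (- K) N y - 2 * y.
Proof.
move=> hN hK wx xy yw.
apply: (ider_le (f := fun z => W (- K) N z - 2 * z) (df := fun z => phi (- K) z *
  (2 * z * M N z - p N z * (2 / z + (4 * - K - 3 / 8) / z ^+ 3
    - 2 * - K / z ^+ 4 + 2 * (- K) ^+ 2 / z ^+ 5)) - 2) xy) => z /andP[xz zy].
  have hz : w N <= z <= w N.+1 by rewrite (le_trans wx xz) (le_trans zy yw).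
  have z0 : 0 < z by have := x2 hN hz; lra.
  have h := iderD (ider_wronskian (- K) z0 (dp N z0) (dg N z0))
    (iderN (iderM (ider_cst z 2) (ider_id z))).
  by apply: (ider_eq h); rewrite mulr0 addr0 mulr1.
have hz : w N <= z <= w N.+1 by rewrite (le_trans wx xz) (le_trans zy yw).
have z2 := x2 hN hz; have z0 : 0 < z by lra.
have p1 := p_ge1 hN hz.
rewrite subr_ge0; set D := (X in _ <= _ * X).
suff hD : 2 / z ^+ 3 <= D.
  apply: (@le_trans _ _ (z ^+ 3 * (2 / z ^+ 3))).
    by rewrite mulrCA divff ?mulr1// expf_neq0// gt_eqF.
  apply: ler_pM => //; rewrite ?exprn_ge0 ?divr_ge0 ?exprn_ge0 ?(ltW z0)//.
  by apply: cube_le_phi => //; lra.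
have /andP[h _] := odeM hN hz; rewrite /D.
apply: (@le_trans _ _ (p N z * (2 / z ^+ 3))).
  by rewrite ler_peMl// divr_ge0 ?exprn_ge0 ?(ltW z0).
rewrite lerBrDr; apply: le_trans h; rewrite -mulrDr ler_pM2l; last by lra.
rewrite -subr_ge0.
have -> : 2 / z - 2 * C / z ^+ 3 - (2 / z ^+ 3 + (2 / z + (4 * - K - 3 / 8) / z ^+ 3
    - 2 * - K / z ^+ 4 + 2 * (- K) ^+ 2 / z ^+ 5)) =
   ((4 * K + 3 / 8 - 2 * C - 2) * z ^+ 2 - 2 * K * z - 2 * K ^+ 2) / z ^+ 5.
  by field; rewrite gt_eqF.
rewrite divr_ge0 ?exprn_ge0 ?(ltW z0)//.
have -> : 2 * C = 2 * K - 2 by rewrite /K; ring.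
have zK : 2 * K <= z ^+ 2.
  by apply: le_trans hK _; rewrite lerXn2r ?nnegrE ?(ltW z0)//; 
     [have := w2 hN; lra | exact: le_trans wx xz].
have : 0 <= K * (z ^+ 2 - 2 * K) by rewrite mulr_ge0 ?subr_ge0.
have : 0 <= K * z * (z - 2) by rewrite !mulr_ge0 ?subr_ge0// ltW.
by have := sqr_ge0 z; nra.
Qed.

Let wlim A : exists2 N1, (N0 <= N1)%N & forall N, (N1 <= N)%N -> A <= w N.
Proof.
have /cvgryPge/(_ A)[N1 _ h] := woo.
exists (maxn N0 N1); first exact: leq_maxl.
by move=> N hN; apply: h => /=; apply: leq_trans hN; exact: leq_maxr.
Qed.

(** The Wronskian stays below its initial value, so the ratio becomes nonincreasing once the
    primitive of an integrable bound is added. The limit might still be 0; [ratio_lower] excludes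
    this. *)
Let cvg_ratio_upper : cvgn (fun N => p N (w N) / phi K (w N)).
Proof.
(* [B] is such that -4 B e^(-4x) cancels the bound of [invphi2_le] times [W0]. *)
pose W0 := `|W K N0 (w N0)|; pose B := W0 / 2 * expR (4 * K).
have W0_ge0 : 0 <= W0 := normr_ge0 _.
have WN N : (N0 <= N)%N -> W K N (w N) <= W0.
  move=> hN; apply: (@le_trans _ _ (W K N0 (w N0))); last exact: ler_norm.
  apply: (nonincr_from (u := fun N => W K N (w N)) (N0 := N0)) => [n hn|].
    by rewrite -W_glue; apply: W_nonincr.
  by rewrite leqnn.
have e0 : (fun N => expR (- (4 * w N))) @ \oo --> (0 : R).
  apply: (cvg_comp (fun N => 4 * w N) (fun x => expR (- x))); last exact: cvgr_expR.
  apply: (cvg_comp w (fun x => 4 * x)); first exact: woo.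
  apply/cvgryPge => A; exists (A / 4); split; first exact: num_real.
  by move=> x /= h; lra.
have h : cvgn (fun N => p N (w N) / phi K (w N) + B * expR (- (4 * w N))).
  apply: (@nonincr_from_cvg _ _ N0 0) => N hN; last first.
    rewrite addr_ge0 ?mulr_ge0 ?expR_ge0 ?invr_ge0//; try lra.
      by have := @p_ge1 N (w N) hN; rewrite lexx ww => /(_ isT); lra.
    exact: ltW (phi_gt0 _ _).
  rewrite -glue_p -lerN2.
  apply: (ider_le (f := fun z => - (p N z / phi K z + B * expR (- (4 * z))))
    (df := fun z => - (2 * z / phi K z ^+ 2 * W K N z
       + B * (expR (- (4 * z)) * (- 4)))) (ww N)) => z /andP[xz zy].
    have hz : w N <= z <= w N.+1 by rewrite xz zy.
    have z0 : 0 < z by have := x2 hN hz; lra.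
    have h := iderN (iderD (ider_ratio K z0 (dp N z0)) (iderM (ider_cst z B)
      (ider_exp (iderN (iderM (ider_cst z 4) (ider_id z)))))).
    by apply: (ider_eq h); rewrite !mulr0 !addr0 mulr1.
  have hz : w N <= z <= w N.+1 by rewrite xz zy.
  have z2 := x2 hN hz; rewrite oppr_ge0 mulrN mulrN subr_le0.
  apply: (@le_trans _ _ (2 * z / phi K z ^+ 2 * W0)).
    apply: ler_wpM2l; first by rewrite divr_ge0 ?sqr_ge0//; lra.
    by apply: le_trans (WN _ hN); apply: W_nonincr.
  apply: (@le_trans _ _ (2 * expR (4 * K) * expR (- (4 * z)) * W0)).
    by apply: ler_wpM2r => //; apply: invphi2_le => //; lra.
  by rewrite /B le_eqVlt; apply/orP; left; apply/eqP; field.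
have -> : (fun N => p N (w N) / phi K (w N)) =
   (fun N => (p N (w N) / phi K (w N) + B * expR (- (4 * w N)))
      - B * expR (- (4 * w N))).
  by apply/funext => N; rewrite addrK.
apply: is_cvgB => //; apply: is_cvgM; first exact: is_cvg_cst.
exact: cvgP e0.
Qed.

Let ratio_lower : exists2 r : R, 0 < r &
  \forall N \near \oo, r <= p N (w N) / phi 0 (w N).
Proof.
have [N1 N01 hN1] := wlim (2 * K).
have wK N : (N1 <= N)%N -> 2 * K <= w N ^+ 2.
  by move=> hN; have := hN1 _ hN; have := w2 (leq_trans N01 hN); nra.
pose B := W (- K) N1 (w N1) - 2 * w N1.
have WB N : (N1 <= N)%N -> B + 2 * w N <= W (- K) N (w N).
  move=> hN; rewrite -lerBrDr -lerN2.
  apply: (nonincr_from (u := fun N => - (W (- K) N (w N) - 2 * w N)) (N0 := N1)).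
    move=> n hn; rewrite lerN2 -W_glue.
    by apply: W_grow; rewrite ?wK// (leq_trans N01 hn).
  by rewrite leqnn.
have [N2 _ hN2] := wlim (- B); pose N3 := maxn N1 N2.
have W_ge0 N : (N3 <= N)%N -> 0 <= W (- K) N (w N).
  rewrite geq_max => /andP[h1 h2]; apply: le_trans (WB _ h1).
  by have := hN2 _ h2; have := w2 (leq_trans N01 h1); lra.
have N03 : (N0 <= N3)%N by rewrite leq_max N01.
have mono N : (N3 <= N)%N -> - (p N.+1 (w N.+1) / phi (- K) (w N.+1)) <=
    - (p N (w N) / phi (- K) (w N)).
  move=> hN; rewrite lerN2 -glue_p; have h0 := leq_trans N03 hN.
  apply: (ider_le (f := fun z => p N z / phi (- K) z)
    (df := fun z => 2 * z / phi (- K) z ^+ 2 * W (- K) N z) (ww N)) => z /andP[xz zy].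
    have hz : w N <= z <= w N.+1 by rewrite xz zy.
    have z0 : 0 < z by have := x2 h0 hz; lra.
    exact: ider_ratio z0 (dp N z0).
  have hz : w N <= z <= w N.+1 by rewrite xz zy.
  have z2 := x2 h0 hz.
  apply: mulr_ge0; first by rewrite divr_ge0 ?sqr_ge0//; lra.
  have := W_ge0 _ hN; have hK : 2 * K <= w N ^+ 2.
    by apply: wK; apply: leq_trans hN; exact: leq_maxl.
  have := W_grow h0 hK (lexx _) xz zy; lra.
exists (p N3 (w N3) / phi (- K) (w N3)).
  rewrite divr_gt0 ?phi_gt0//.
  by have := @p_ge1 N3 (w N3) N03; rewrite lexx ww => /(_ isT); lra.
exists N3 => // N /= hN.
apply: (@le_trans _ _ (p N (w N) / phi (- K) (w N))).
  rewrite -lerN2.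
  by apply: (nonincr_from (u := fun N => - (p N (w N) / phi (- K) (w N))) mono);
     rewrite leqnn.
have h0 := leq_trans N03 hN.
rewrite ler_wpM2l//.
  by have := @p_ge1 N (w N) h0; rewrite lexx ww => /(_ isT); lra.
rewrite lef_pV2 ?posrE ?phi_gt0// /phi ler_expR mulr0 mul0r subr0 mulrN mulNr opprK.
by rewrite lerDl divr_ge0 ?mulr_ge0//; have := w2 h0; lra.
Qed.

Lemma liouville_green :
  exists2 L : R, 0 < L & (fun N => p N (w N) / phi 0 (w N)) @ \oo --> L.
Proof.
have [r r0 hr] := ratio_lower.
have /cvg_ex[/= L hL] := cvg_ratio_upper.
(* This is phi K / phi 0, so both ratios have the same limit. *)
have e1 : (fun N => expR (- (2 * K / w N))) @ \oo --> (1 : R).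
  have h : (fun N => - (2 * K / w N)) @ \oo --> - (2 * K * 0).
    apply: cvgN; apply: cvgM; first exact: cvg_cst.
    apply/gtr0_cvgV0; last exact: woo.
    by have [N1 _ h] := wlim 1; exists N1 => // n /h /= ?; lra.
  have : (fun N => expR (- (2 * K / w N))) @ \oo --> expR (- (2 * K * 0)).
    by apply: continuous_cvg; [exact: continuous_expR|exact h].
  by rewrite mulr0 oppr0 expR0.
have h0 : (fun N => p N (w N) / phi 0 (w N)) @ \oo --> L.
  rewrite -[L]mulr1.
  have -> : (fun N => p N (w N) / phi 0 (w N)) =
     (fun N => p N (w N) / phi K (w N) * expR (- (2 * K / w N))).
    apply/funext => N; rewrite -mulrA; congr (_ * _).
    by rewrite /phi -!expRN -expRD; congr expR; ring.
  exact: cvgM.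
exists L => //; apply: lt_le_trans r0 _.
exact: cvgr_to_ge h0 hr.
Qed.

End Asymptotics.

(** * Prime-power sums and the differential equation *)

Section PrimePowerSums.
Variable R : realType.
Implicit Types (n k N : nat).

Lemma sum_pow_le n N k (c : R) : (2 <= k)%N -> (0 < n <= N)%N ->
  \sum_(1 <= j < N.+1 | (k ^ j <= n)%N) c = (trunc_log k n)%:R * c.
Proof.
move=> k2 /andP[n0 nN]; set t := trunc_log k n.
have kt j : (k ^ j <= n)%N = (j <= t)%N.
  apply/idP/idP => h; first exact: trunc_log_max.
  by apply: leq_trans (trunc_logP k2 n0); rewrite leq_exp2l.
have tN : (t <= N)%N.
  apply: leq_trans nN; apply: leq_trans (trunc_logP k2 n0).
  by apply: ltnW; apply: ltn_expl.
rewrite (eq_bigl (fun j => (j < t.+1)%N)); last by move=> j; rewrite kt ltnS.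
rewrite -(big_nat_widen _ _ _ predT)//.
by rewrite sumr_const_nat subSS subn0 mulr_natl.
Qed.

(* [psi_sum n] is the sum of [ln k] over the pairs [k, j] with [k ^ j <= n]. *)
Definition psi_sum n : R := \sum_(2 <= k < n.+1) (trunc_log k n)%:R * ln k%:R.

Lemma trunc_log_small k n : (n < k)%N -> trunc_log k n = 0%N.
Proof.
move=> nk; apply/eqP; rewrite -leqn0 leqNgt; apply/negP => h.
have [n0|n0] := posnP n; first by move: h; rewrite n0 trunc_log0.
have k2 : (1 < k)%N by lia.
have := trunc_logP k2 n0; apply/negP; rewrite -ltnNge; apply: leq_trans nk _.
by rewrite -[X in (X <= _)%N]expn1 leq_exp2l.
Qed.

Lemma psi_sumE n N : (0 < n <= N)%N ->
  \sum_(2 <= k < N.+1) \sum_(1 <= j < N.+1 | (k ^ j <= n)%N) ln k%:R =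
  psi_sum n :> R.
Proof.
move=> /andP[n0 nN].
transitivity (\sum_(2 <= k < N.+1) (trunc_log k n)%:R * ln k%:R : R).
  by apply: eq_big_nat => k /andP[k2 _]; rewrite sum_pow_le// n0.
have [n1|n2] := leqP n 1.
  rewrite /psi_sum (@big_geq _ _ _ 2 n.+1)//; apply: big1_seq => k /andP[_].
  by rewrite mem_index_iota => kN; rewrite trunc_log_small ?mul0r//; lia.
rewrite (@big_cat_nat _ _ _ n.+1)//=.
rewrite [X in _ + X]big1_seq ?addr0// => k /andP[_].
by rewrite mem_index_iota => kN; rewrite trunc_log_small ?mul0r//; lia.
Qed.

Lemma trunc_log_ln_le k n : (2 <= k)%N -> (0 < n)%N ->
  (trunc_log k n)%:R * ln k%:R <= ln n%:R :> R.
Proof.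
move=> k2 n0; have k0 : 0 < k%:R :> R by rewrite ltr0n; lia.
rewrite mulr_natl -lnXn// -natrX ler_ln ?posrE ?ltr0n ?expn_gt0//; last lia.
by rewrite ler_nat trunc_logP.
Qed.

(** Telescoping: with r^4 = k and s^4 = k - 1, 1 = r^4 - s^4 <= 4 (r - s) r^3, that is k^(-3/4) <= 4
    (r - s). *)
Lemma sum_inv34_le n : (0 < n)%N ->
  \sum_(2 <= k < n.+1) expR (- (3 / 4 * ln k%:R)) <= 4 * expR (ln n%:R / 4) :> R.
Proof.
elim: n => // -[|n] IH _; first by rewrite big_geq// mulr_ge0// expR_ge0.
rewrite big_nat_recr//=.
have {IH} := IH isT; set A := \sum_(_ <= _ < _) _.
suff : expR (- (3 / 4 * ln n.+2%:R)) <=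
  4 * (expR (ln n.+2%:R / 4) - expR (ln n.+1%:R / 4)) :> R by lra.
set r := expR (ln n.+2%:R / 4); set s := expR (ln n.+1%:R / 4).
have r0 : 0 < r := expR_gt0 _; have s0 : 0 < s := expR_gt0 _.
have r4 : r ^+ 4 = n.+2%:R.
  by rewrite /r -expRM_natl mulrCA divff// mulr1 lnK// posrE ltr0n.
have s4 : s ^+ 4 = n.+1%:R.
  by rewrite /s -expRM_natl mulrCA divff// mulr1 lnK// posrE ltr0n.
have -> : expR (- (3 / 4 * ln n.+2%:R)) = (r ^+ 3)^-1.
  by rewrite expRN /r -expRM_natl; congr (expR _)^-1; ring.
have sr : s <= r.
  by rewrite ler_expR ler_pM2r// ler_ln ?posrE ?ltr0n// ler_nat.
have r3 : 0 < r ^+ 3 by rewrite exprn_gt0.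
rewrite -(ler_pM2r r3) mulVf ?gt_eqF//.
have e1 : r ^+ 4 - s ^+ 4 = 1 by rewrite r4 s4 -[n.+2]addn1 natrD; ring.
have -> : 4 * (r - s) * r ^+ 3 = (r - s) * (4 * r ^+ 3) by ring.
rewrite -[leLHS]e1 (_ : _ - _ = (r - s) * (r ^+ 3 + r ^+ 2 * s + r * s ^+ 2 + s ^+ 3));
  last by ring.
rewrite ler_wpM2l ?subr_ge0//.
have h1 : r ^+ 2 * s <= r ^+ 3 by rewrite [r ^+ 3]exprSr ler_wpM2l// exprn_ge0// ltW.
have h2 : r * s ^+ 2 <= r ^+ 3.
  by rewrite [r ^+ 3]exprS ler_wpM2l ?(ltW r0)// lerXn2r ?nnegrE ?(ltW r0) ?(ltW s0).
have h3 : s ^+ 3 <= r ^+ 3 by rewrite lerXn2r ?nnegrE ?(ltW r0) ?(ltW s0).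
lra.
Qed.

(** Each exponent j is bounded by the case j = 1, and the number of exponents times ln k is at most
    ln n. *)
Lemma sum_pow_inv34_le n N : (0 < n <= N)%N ->
  \sum_(2 <= k < N.+1) \sum_(1 <= j < N.+1 | (k ^ j <= n)%N)
    ln k%:R * expR (- (3 / 4 * ln (k ^ j)%:R)) <=
  ln n%:R * (4 * expR (ln n%:R / 4)) :> R.
Proof.
move=> /andP[n0 nN].
have lnn : 0 <= ln n%:R :> R by rewrite ln_ge0// ler1n.
apply: (@le_trans _ _ (\sum_(2 <= k < N.+1) (if (k < n.+1)%N then
    ln n%:R * expR (- (3 / 4 * ln k%:R)) else 0))).
  rewrite big_seq [X in _ <= X]big_seq; apply: ler_sum => k.
  rewrite mem_index_iota => /andP[k2 kN].
  have lk : 0 <= ln k%:R :> R by rewrite ln_ge0// ler1n; lia.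
  apply: (@le_trans _ _ (\sum_(1 <= j < N.+1 | (k ^ j <= n)%N)
    ln k%:R * expR (- (3 / 4 * ln k%:R)))).
    rewrite big_seq_cond [X in _ <= X]big_seq_cond; apply: ler_sum => j.
    rewrite mem_index_iota => /andP[/andP[j1 _] _].
    rewrite ler_wpM2l// ler_expR lerN2 ler_pM2l//.
    rewrite ler_ln ?posrE ?ltr0n ?expn_gt0 ?ler_nat//; try lia.
    by rewrite -[X in (X <= _)%N]expn1 leq_exp2l.
  rewrite sum_pow_le// ?n0//; case: ltnP => kn.
    by rewrite mulrA ler_wpM2r ?expR_ge0// trunc_log_ln_le.
  by rewrite trunc_log_small// mul0r.
rewrite -big_mkcond /= -(big_nat_widen _ _ _ predT)// -mulr_sumr.
by rewrite ler_wpM2l// sum_inv34_le.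
Qed.

End PrimePowerSums.

(** * Stirling-type bounds *)

Section Stirling.
Variable R : realType.
Implicit Types (n k : nat) (y z : R).

Lemma ln_le_sub1 y : 0 < y -> ln y <= y - 1.
Proof. by move=> y0; have := @le_ln1Dx R (y - 1); rewrite addrCA subrr addr0; apply; lra. Qed.

Lemma ln_diff_le y z : 0 < y -> 0 < z -> y * (ln z - ln y) <= z - y.
Proof.
move=> y0 z0; rewrite -ln_div ?posrE//.
have -> : z - y = y * (z / y - 1) by field; rewrite gt_eqF.
by rewrite ler_pM2l// ln_le_sub1// divr_gt0.
Qed.

(** The tangent inequality, used in both directions, controls the increments of n ln n - n. *)
Lemma sum_ln_bounds n : (0 < n)%N ->
  n%:R * ln n%:R - n%:R + 1 <= \sum_(2 <= k < n.+1) ln (k%:R : R) <=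
  n%:R * ln n%:R - n%:R + 1 + ln n%:R.
Proof.
elim: n => // -[|n] IH _.
  by rewrite big_geq// ln1 mulr0; apply/andP; split; lra.
rewrite big_nat_recr//=; have /andP[] := IH isT; set A := \sum_(_ <= _ < _) _.
have n0 : 0 < n.+1%:R :> R by rewrite ltr0n.
have m0 : 0 < n.+2%:R :> R by rewrite ltr0n.
have := ln_diff_le n0 m0; have := ln_diff_le m0 n0.
have -> : n.+2%:R = n.+1%:R + 1 :> R by rewrite -[n.+2]addn1 natrD.
set x := n.+1%:R; set a := ln x; set b := ln (x + 1) => h1 h2 h3 h4.
by apply/andP; split; lra.
Qed.

Lemma count_le_real (r : R) n : 0 <= r ->
  \sum_(2 <= k < n | k%:R <= r) (1 : R) <= r.
Proof.
move=> r0; case: n => [|n]; first by rewrite big_geq.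
(* The second claim serves the case where the last k satisfies k <= r: the count is then at most
   k. *)
suff [] : \sum_(2 <= k < n.+1 | k%:R <= r) (1 : R) <= r /\
  \sum_(2 <= k < n.+1 | k%:R <= r) (1 : R) + 1 <= n.+1%:R by [].
elim: n => [|n [IH1 IH2]]; first by rewrite big_geq// add0r.
case: n IH1 IH2 => [_ _|n IH1 IH2].
  by rewrite big_geq// add0r; split=> //; rewrite ler1n.
rewrite big_mkcond big_nat_recr//= -big_mkcond /= -[n.+3]addn1 natrD.
by case: ifP => h; [move: IH2 h|move: IH1 IH2];
  set A := \sum_(_ <= _ < _ | _) _ => *; split; lra.
Qed.

(** Exponents above 1 occur for k <= sqrt n only, and each such k adds at most ln n. *)
Lemma psi_sum_bounds n : (0 < n)%N ->
  \sum_(2 <= k < n.+1) ln (k%:R : R) <= psi_sum R n <=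
  \sum_(2 <= k < n.+1) ln k%:R + Num.sqrt n%:R * ln n%:R.
Proof.
move=> n0; have lnn : 0 <= ln n%:R :> R by rewrite ln_ge0// ler1n.
apply/andP; split.
  rewrite /psi_sum big_seq [X in _ <= X]big_seq; apply: ler_sum => k.
  rewrite mem_index_iota => /andP[k2 kn].
  rewrite ler_peMl ?ln_ge0 ?ler1n//; try lia.
  by apply: trunc_log_max => //; rewrite expn1; lia.
rewrite -lerBlDl /psi_sum -sumrB.
apply: (@le_trans _ _ (\sum_(2 <= k < n.+1) (if (k ^ 2 <= n)%N then ln n%:R else 0))).
  rewrite big_seq [X in _ <= X]big_seq; apply: ler_sum => k.
  rewrite mem_index_iota => /andP[k2 kn].
  have lk : 0 <= ln k%:R :> R by rewrite ln_ge0// ler1n; lia.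
  case: leqP => h; first by have := trunc_log_ln_le R k2 n0; lra.
  suff -> : trunc_log k n = 1%N by rewrite mul1r subrr.
  by apply: trunc_log_eq => //; rewrite expn1 h andbT; lia.
rewrite -big_mkcond /=.
rewrite (eq_bigl (fun k => k%:R <= Num.sqrt n%:R :> R)); last first.
  move=> k; rewrite -[k%:R]ger0_norm ?ler0n// -sqrtr_sqr ler_sqrt ?ler0n//.
  by rewrite -natrX ler_nat.
under eq_bigr do rewrite -[ln _]mul1r.
by rewrite -mulr_suml ler_wpM2r// count_le_real// sqrtr_ge0.
Qed.

(** Up to the factor e^-v, this is the share of one partition in v M - P: the term h comes from v =
    ln (prod a) + h, the -1 from e^-h in the kernel. The 12 is 3 times 4, since ln n, h and sqrt n
    ln n are each at most h e^(h/2) <= 4 e^(3h/4). *)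
Lemma psi_sum_stirling n h : (0 < n)%N -> 0 <= h -> n%:R <= expR h <= n%:R + 1 ->
  0 <= psi_sum R n - (expR h * h - expR h) + h - 1 <= 12 * expR (3 / 4 * h).
Proof.
move=> n0 h0 /andP[nh hn].
have n0R : 0 < n%:R :> R by rewrite ltr0n.
have /andP[s1 s2] := sum_ln_bounds n0; have /andP[p1 p2] := psi_sum_bounds n0.
have e0 : 0 < expR h := expR_gt0 h.
have := ln_diff_le n0R e0; have := ln_diff_le e0 n0R; rewrite expRK.
have lnh : ln n%:R <= h by rewrite -ler_expR lnK// posrE.
have l0 : 0 <= ln n%:R :> R by rewrite ln_ge0// ler1n.
have sq : Num.sqrt n%:R <= expR (h / 2).
  rewrite -[leRHS]ger0_norm ?expR_ge0// -sqrtr_sqr ler_sqrt ?sqr_ge0//.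
  by rewrite -expRM_natl mulrCA divff// mulr1.
have sl : Num.sqrt n%:R * ln n%:R <= expR (h / 2) * h.
  by apply: ler_pM => //; exact: sqrtr_ge0.
have h4 : h <= 4 * expR (h / 4) by have := @expR_ge1Dx R (h / 4); lra.
have e2 : 1 <= expR (h / 2) by rewrite -(@expR0 R) ler_expR divr_ge0.
have e34 : expR (h / 2) * h <= 4 * expR (3 / 4 * h).
  apply: (@le_trans _ _ (expR (h / 2) * (4 * expR (h / 4)))).
    by rewrite ler_wpM2l// expR_ge0.
  by rewrite mulrCA -expRD ler_pM2l// ler_expR; lra.
have hh : h <= expR (h / 2) * h by rewrite ler_peMl.
have hx : (expR h - n%:R) * ln n%:R <= 1 * ln n%:R by rewrite ler_wpM2r//; lra.
have hy : (expR h - n%:R) * h <= 1 * h by rewrite ler_wpM2r//; lra.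
have hz : 0 <= (expR h - n%:R) * ln n%:R by rewrite mulr_ge0// subr_ge0.
move: nh hn s1 s2 p1 p2 lnh l0 sl h4 e34 hh hx hy hz.
set x := n%:R; set y := expR h; set l := ln x => *.
by apply/andP; split; lra.
Qed.

End Stirling.

(** * The differential equation for the second primitive *)

Section OdeForMparts.
Variable R : realType.
Implicit Types (N m : nat) (x v : R) (a : seq nat).

Lemma ider_sum (T : Type) (s : seq T) (f df : T -> R -> R) x :
  (forall i, is_derive x 1 (f i) (df i x)) ->
  is_derive x 1 (fun y => \sum_(i <- s) f i y) (\sum_(i <- s) df i x).
Proof.
move=> h; elim: s => [|i s IH].
  by under eq_fun do rewrite big_nil; rewrite big_nil; exact: ider_cst.
by under eq_fun do rewrite big_cons; rewrite big_cons; exact: iderD.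
Qed.

Lemma mpartsS_sum (t : nat -> R) N : t N.+1 = 0 ->
  \sum_(a <- mparts 2 N.+1) t (prodn a) = \sum_(a <- mparts 2 N) t (prodn a).
Proof.
move=> t0; rewrite (bigID (fun a => (prodn a <= N)%N)) /= [X in _ + X]big1_seq.
  rewrite addr0 -big_filter; apply: perm_big; apply: uniq_perm.
  - by rewrite filter_uniq// mparts_uniq.
  - exact: mparts_uniq.
  move=> a; rewrite (mem_filter _ _ (mparts 2 N.+1)) !mem_mparts//.
  by apply/idP/idP => [/andP[-> /and3P[-> ->]]//|/and3P[-> -> h]]; rewrite h leqW.
move=> a; rewrite mem_mparts// => /andP[h /and3P[_ _ h2]].
suff -> : prodn a = N.+1 by [].
by apply/eqP; rewrite eqn_leq h2 ltnNge.
Qed.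

(** A partition of product m adds e^-t to M from t = ln m on. [tp] and [tg] are the second and first
    primitives of e^-t that vanish there, so new partitions do not break the gluing at ln m. *)
Let tp m x : R := (x ^+ 2 - ln m%:R - 1) / m%:R + expR (- x ^+ 2).
Let tg m x : R := m%:R^-1 - expR (- x ^+ 2).

(* With [F] the number of multiplicative partitions with product [<= e ^ t] and
   [M t = F t * e ^ - t], these are [M], its primitive [g] and its second
   primitive [p] at [t = x ^+ 2], as long as [N <= e ^ t <= N + 1]. *)
Definition mp_p N x : R := \sum_(a <- mparts 2 N) tp (prodn a) x.
Definition mp_g N x : R := \sum_(a <- mparts 2 N) tg (prodn a) x.
Definition mp_M N x : R := (size (mparts 2 N))%:R * expR (- x ^+ 2).

Let w N : R := Num.sqrt (ln N%:R).

Let ider_sqr x : is_derive x 1 (fun y : R => y ^+ 2) (2 * x).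
Proof.
have h := iderM (ider_id x) (ider_id x).
by under eq_fun do rewrite expr2; apply: (ider_eq h); ring.
Qed.

Lemma ider_mp_p N x : is_derive x 1 (mp_p N) (2 * x * mp_g N x).
Proof.
rewrite /mp_g mulr_sumr; apply: (@ider_sum _ _ _ (fun a y => 2 * y * tg (prodn a) y)) => a.
have hx := ider_sqr x.
have h := iderD (iderM (iderD (iderD hx (ider_cst x (- ln (prodn a)%:R)))
   (ider_cst x (- 1))) (ider_cst x (prodn a)%:R^-1)) (ider_exp (iderN hx)).
by apply: (ider_eq h); rewrite /tg; ring.
Qed.

Lemma ider_mp_g N x : is_derive x 1 (mp_g N) (2 * x * mp_M N x).
Proof.
have -> : 2 * x * mp_M N x = \sum_(a <- mparts 2 N) 2 * x * expR (- x ^+ 2).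
  by rewrite big_const_seq count_predT iter_addr_0 /mp_M -[RHS]mulr_natl; ring.
apply: (@ider_sum _ _ _ (fun a y => 2 * y * expR (- y ^+ 2))) => a.
have h := iderD (ider_cst x (prodn a)%:R^-1) (iderN (ider_exp (iderN (ider_sqr x)))).
by apply: (ider_eq h); ring.
Qed.

Lemma sqr_w N : (0 < N)%N -> w N ^+ 2 = ln N%:R.
Proof. by move=> N0; rewrite sqr_sqrtr// ln_ge0// ler1n. Qed.

Lemma mp_p_glue N : mp_p N (w N.+1) = mp_p N.+1 (w N.+1).
Proof.
rewrite /mp_p (mpartsS_sum (t := fun m => tp m (w N.+1)))// /tp sqr_w//.
by rewrite expRN lnK ?posrE ?ltr0n//; field; rewrite gt_eqF// ltr0n.
Qed.

Lemma mp_g_glue N : mp_g N (w N.+1) = mp_g N.+1 (w N.+1).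
Proof.
rewrite /mp_g (mpartsS_sum (t := fun m => tg m (w N.+1)))// /tg sqr_w//.
by rewrite expRN lnK ?posrE ?ltr0n// subrr.
Qed.

Let kern (h : R) : R := h - 1 + expR (- h).

Lemma kern_ge0 h : 0 <= kern h.
Proof. by rewrite /kern; have := @expR_ge1Dx R (- h); lra. Qed.

Lemma kern_lin h : 1 / 2 <= h -> h <= 8 * kern h.
Proof.
move=> h12; rewrite /kern; have e0 : 0 <= expR (- h) := expR_ge0 _.
have [h2|h2] := leP 2 h; first lra.
(* Hence kern h >= h^2 / 4, and this is at least h / 8 for h >= 1/2. *)
have : (1 - h / 2) ^+ 2 <= expR (- h).
  rewrite (_ : - h = 2%:R * (- (h / 2))); last by field.
  rewrite expRM_natl; apply: lerXn2r; rewrite ?nnegrE ?expR_ge0//; first lra.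
  exact: expR_ge1Dx.
by move=> h3; nra.
Qed.

Let tp_kern m x : (0 < m)%N -> tp m x = kern (x ^+ 2 - ln m%:R) / m%:R.
Proof.
move=> m0; have m0R : 0 < m%:R :> R by rewrite ltr0n.
rewrite /tp /kern mulrDl opprB expRD lnK ?posrE//.
by field; rewrite gt_eqF.
Qed.

Lemma mparts_prod_gt0 d N a : (2 <= d)%N -> a \in mparts d N -> (0 < prodn a)%N.
Proof.
move=> d2; rewrite mem_mparts// => /and3P[_ a2 _].
by apply: prod_ge1; apply: all_leq_trans a2; exact: ltnW.
Qed.

Lemma mp_p_ge N x : (0 < N)%N -> x ^+ 2 - 1 <= mp_p N x.
Proof.
move=> N0; have h : [::] \in mparts 2 N by rewrite mem_mparts//= big_nil.
rewrite /mp_p (big_rem _ h) /= big_nil.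
rewrite /tp ln1 invr1 mulr1 subr0 -addrA lerDl addr_ge0 ?expR_ge0//.
rewrite big_seq; apply: sumr_ge0 => a /mem_rem/mparts_prod_gt0 a0.
by rewrite -/(tp _ _) tp_kern ?a0// mulr_ge0 ?kern_ge0 ?invr_ge0.
Qed.

Section Estimate.
Variables (N : nat) (x : R).
Hypothesis N0 : (0 < N)%N.
Hypothesis Nx : N%:R <= expR (x ^+ 2) <= N%:R + 1.
Let v := x ^+ 2.
Let h a : R := v - ln (prodn a)%:R.
Let n a := (N %/ prodn a)%N.

Let n_h a : a \in mparts 2 N ->
  [/\ (0 < prodn a)%N, (0 < n a <= N)%N, 0 <= h a & (n a)%:R <= expR (h a) <= (n a)%:R + 1].
Proof.
move=> am; have a0 := mparts_prod_gt0 (leqnn 2) am.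
move: am; rewrite mem_mparts// => /and3P[_ _ aN].
have a0R : 0 < (prodn a)%:R :> R by rewrite ltr0n.
have na : (0 < n a)%N by rewrite divn_gt0.
have eh : expR (h a) = expR v / (prodn a)%:R.
  by rewrite /h expRB lnK// posrE.
have /andP[Nx1 Nx2] := Nx.
have b : (n a)%:R <= expR (h a) <= (n a)%:R + 1.
  rewrite eh ler_pdivlMr// ler_pdivrMr//; apply/andP; split.
    by apply: le_trans Nx1; rewrite -natrM ler_nat leq_divM.
  apply: le_trans Nx2 _; rewrite !natr1 -natrM ler_nat.
  exact: ltn_ceil.
split=> //; first by rewrite na leq_div.
have /andP[b1 _] := b; rewrite -ler_expR expR0; apply: le_trans b1.
by rewrite ler1n.
Qed.

(** The errors y^(3/4) at y = e^(h a), multiplied by e^-v and summed. *)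
Let Q : R := \sum_(a <- mparts 2 N) expR (- (h a / 4)) / (prodn a)%:R.

Let expv a : (0 < prodn a)%N -> expR (- v) = expR (- h a) / (prodn a)%:R.
Proof.
move=> a0; rewrite /h opprB addrC expRD lnK ?posrE ?ltr0n// mulfK//.
by rewrite gt_eqF// ltr0n.
Qed.

Let ln_prod a : all (leq 2) a -> ln (prodn a)%:R = \sum_(k <- a) ln k%:R :> R.
Proof.
elim: a => [|k a IH]; first by rewrite !big_nil ln1.
move=> /= /andP[k2 a2]; rewrite !big_cons natrM lnM ?IH//.
  by rewrite posrE ltr0n; lia.
by rewrite posrE ltr0n prod_ge1//; exact: all_leq_trans a2.
Qed.

Let log_identity (K : nat -> R) :
  \sum_(a <- mparts 2 N) ln (prodn a)%:R * K (prodn a) =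
  \sum_(a <- mparts 2 N) \sum_(2 <= k < N.+1)
    \sum_(1 <= j < N.+1 | (k ^ j <= n a)%N) ln k%:R * K (prodn a * k ^ j)%N.
Proof.
transitivity (\sum_(a <- mparts 2 N) (\sum_(x <- a) ln x%:R) * K (prodn a)).
  rewrite big_seq [RHS]big_seq; apply: eq_bigr => a.
  by rewrite mem_mparts// => /and3P[_ a2 _]; rewrite ln_prod.
rewrite (mparts_log_identity (fun k => ln k%:R : R)).
rewrite big_seq [RHS]big_seq; apply: eq_bigr => a /n_h[a0 _ _ _].
apply: eq_bigr => k _; apply: eq_bigl => j.
by rewrite /n leq_divRL// mulnC.
Qed.

(** In v M, write v = ln (prod a) + h a; the logarithmic identity replaces the first part by
    [psi_sum (n a)], and [psi_sum_stirling] applies termwise. *)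
Lemma mp_ode_Q : 0 <= v * mp_M N x - mp_p N x <= 12 * Q.
Proof.
have -> : v * mp_M N x - mp_p N x = \sum_(a <- mparts 2 N)
   (psi_sum R (n a) - (expR (h a) * h a - expR (h a)) + h a - 1) * expR (- v).
  have -> : v * mp_M N x = \sum_(a <- mparts 2 N)
      (psi_sum R (n a) + h a) * expR (- v).
    transitivity (\sum_(a <- mparts 2 N) (ln (prodn a)%:R * expR (- v) + h a * expR (- v))).
      under eq_bigr do rewrite -mulrDl /h addrC subrK.
      by rewrite big_const_seq count_predT iter_addr_0 /mp_M -[RHS]mulr_natl /v; ring.
    rewrite big_split /= (log_identity (fun=> expR (- v))) -big_split /=.
    rewrite big_seq [RHS]big_seq; apply: eq_bigr => a /n_h[_ na _ _].
    rewrite [RHS]mulrDl; congr (_ + _); rewrite -(psi_sumE R na) mulr_suml.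
    by apply: eq_bigr => k _; rewrite mulr_suml.
  rewrite /mp_p -sumrB big_seq [RHS]big_seq; apply: eq_bigr => a /n_h[a0 _ _ _].
  rewrite tp_kern// -/v -/(h a) /kern (expv a0).
  by rewrite expRN; field; rewrite ?expR_eq0 ?pnatr_eq0 -?lt0n ?a0.
apply/andP; split.
  rewrite big_seq; apply: sumr_ge0 => a /n_h[a0 /andP[na _] ha nh].
  by have /andP[? _] := psi_sum_stirling na ha nh; rewrite mulr_ge0// expR_ge0.
rewrite /Q mulr_sumr big_seq [leRHS]big_seq; apply: ler_sum => a /n_h[a0 /andP[na _] ha nh].
have /andP[_ s] := psi_sum_stirling na ha nh.
rewrite (expv a0) !mulrA ler_pM2r ?invr_gt0 ?ltr0n//.
have -> : expR (- (h a / 4)) = expR (3 / 4 * h a) * expR (- h a).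
  by rewrite -expRD; congr expR; field.
by rewrite mulrA ler_wpM2r ?expR_ge0.
Qed.

(** The same splitting of v in v Q, where e^(-h/4) / m = m^(-3/4) e^(-v/4) for m = prod a. If n a >=
    2, then h >= 1/2 and the terms are at most 4 h + h <= 40 kern h. If n a = 1, the kernel may
    vanish, but h <= 1 and the term of Q suffices. *)
Lemma mp_Q_le : (v - 1) * Q <= 40 * mp_p N x.
Proof.
rewrite mulrBl mul1r lerBlDr.
have -> : v * Q = \sum_(a <- mparts 2 N)
    (ln (prodn a)%:R * expR (- (h a / 4)) / (prodn a)%:R
     + h a * expR (- (h a / 4)) / (prodn a)%:R).
  rewrite /Q mulr_sumr; apply: eq_bigr => a _.
  by rewrite /h; ring.
pose K m : R := expR (- (3 / 4 * ln m%:R)).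
have Kh a : (0 < prodn a)%N ->
    expR (- (h a / 4)) / (prodn a)%:R = K (prodn a) * expR (- (v / 4)).
  move=> a0; rewrite -[X in _ / X]lnK ?posrE ?ltr0n// -expRN /K -!expRD.
  by congr expR; rewrite /h; field.
rewrite big_split /=.
have -> : \sum_(a <- mparts 2 N) ln (prodn a)%:R * expR (- (h a / 4)) / (prodn a)%:R
  = (\sum_(a <- mparts 2 N) ln (prodn a)%:R * K (prodn a)) * expR (- (v / 4)).
  rewrite mulr_suml big_seq [RHS]big_seq; apply: eq_bigr => a /n_h[a0 _ _ _].
  by rewrite -[LHS]mulrA -[RHS]mulrA Kh.
rewrite log_identity mulr_suml -big_split /= /mp_p /Q mulr_sumr -big_split /=.
rewrite big_seq [leRHS]big_seq; apply: ler_sum => a /n_h[a0 na ha nh].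
have a0R : 0 < (prodn a)%:R :> R by rewrite ltr0n.
rewrite tp_kern// -/v -/(h a).
have /andP[na0 _] := na.
have l0 : 0 <= ln (n a)%:R :> R by rewrite ln_ge0// ler1n.
have lnh : ln (n a)%:R <= h a.
  by rewrite -ler_expR lnK ?posrE ?ltr0n//; case/andP: nh.
apply: (@le_trans _ _ (K (prodn a) * (ln (n a)%:R * (4 * expR (ln (n a)%:R / 4)))
    * expR (- (v / 4)) + h a * expR (- (h a / 4)) / (prodn a)%:R)).
  rewrite lerD2r ler_wpM2r ?expR_ge0//.
  apply: le_trans (ler_wpM2l (expR_ge0 _) (sum_pow_inv34_le R na)).
  rewrite le_eqVlt; apply/orP; left; apply/eqP.
  rewrite mulr_sumr; apply: eq_big_nat => k /andP[k2 _]; rewrite mulr_sumr.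
  apply: eq_bigr => j _; rewrite /K natrM lnM ?posrE ?ltr0n ?expn_gt0//; last lia.
  by rewrite mulrDr opprD expRD mulrCA.
rewrite mulrAC -Kh//.
set t := ln (n a)%:R * _; set E := expR (- (h a / 4)).
rewrite [leLHS](_ : _ = (E * t + h a * E) / (prodn a)%:R); last by ring.
rewrite [leRHS](_ : _ = (40 * kern (h a) + E) / (prodn a)%:R); last by ring.
rewrite /t /E {t E}.
rewrite ler_pM2r ?invr_gt0//.
have [n1|n2] := leqP (n a) 1.
  have -> : n a = 1%N by apply/eqP; rewrite eqn_leq n1.
  rewrite ln1 mul0r mulr0 add0r; have := kern_ge0 (h a).
  suff h1 : h a * expR (- (h a / 4)) <= expR (- (h a / 4)) by lra.
  rewrite ler_piMl ?expR_ge0// -ler_expR.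
  have /andP[_] := nh; have -> : n a = 1%N by apply/eqP; rewrite eqn_leq n1.
  by have := @expR_ge1Dx R 1; lra.
have h12 : 1 / 2 <= h a.
  rewrite -ler_expR; apply: (@le_trans _ _ (n a)%:R); last by case/andP: nh.
  apply: (@le_trans _ _ 2); last by rewrite ler_nat.
  rewrite -[1 / 2]opprK expRN -[leRHS]invrK lef_pV2 ?posrE ?expR_gt0 ?invr_gt0//.
  by have := @expR_ge1Dx R (- (1 / 2)); lra.
have k8 := kern_lin h12.
have e1 : expR (- (h a / 4)) <= 1 by rewrite expR_le1 oppr_le0 divr_ge0.
have e0 : 0 <= expR (- (h a / 4)) := expR_ge0 _.
have t1 : h a * expR (- (h a / 4)) <= h a by rewrite ler_piMr.
have t2 : expR (- (h a / 4)) * (ln (n a)%:R * (4 * expR (ln (n a)%:R / 4))) <= 4 * h a.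
  have -> : 4 * h a = expR (- (h a / 4)) * (h a * (4 * expR (h a / 4))).
    rewrite [_ * (h a * _)]mulrC -!mulrA -expRD subrr expR0 mulr1 mulrC//.
  rewrite ler_wpM2l//; apply: ler_pM; rewrite ?mulr_ge0 ?expR_ge0//.
  by rewrite ler_pM2l// ler_expR ler_pM2r.
lra.
Qed.

(** 960 = 12 * 40 * 2, the 2 bounding v / (v - 1). *)
Lemma mp_ode : 2 <= v -> `|v * mp_M N x - mp_p N x| <= 960 * mp_p N x / v.
Proof.
move=> v2; have /andP[h1 h2] := mp_ode_Q; have h3 := mp_Q_le.
rewrite ger0_norm// ler_pdivlMr; last lra.
have Q0 : 0 <= Q.
  by rewrite /Q sumr_ge0// => a _; rewrite mulr_ge0 ?expR_ge0 ?invr_ge0.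
apply: (@le_trans _ _ (12 * Q * v)); first by rewrite ler_wpM2r//; lra.
have : 0 <= Q * (v - 2) by rewrite mulr_ge0// subr_ge0.
lra.
Qed.

End Estimate.

End OdeForMparts.

(** * Asymptotics of the number of multiplicative partitions *)

Section MainAsymptotics.
Variable R : realType.

Let w (n : nat) : R := Num.sqrt (ln n%:R).

Lemma sqrt_ln_cvgy : w @ \oo --> +oo.
Proof.
apply/cvgryPge => B; near=> n.
have hn : expR (B ^+ 2) <= n%:R by near: n; exact: nbhs_infty_ger.
apply: le_trans (ler_norm B) _; rewrite -sqrtr_sqr /w ler_sqrt ?sqr_ge0//.
  by rewrite -ler_expR lnK// posrE (lt_le_trans (expR_gt0 _) hn).
by rewrite ln_ge0//; apply: le_trans hn; rewrite -expR0 ler_expR sqr_ge0.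
Unshelve. all: by end_near. Qed.

Let w_nd n : w n <= w n.+1.
Proof.
case: n => [|n]; first by rewrite /w ler0_sqrtr ?sqrtr_ge0// ln_le0.
by rewrite ler_sqrt ?ln_ge0 ?ler1n// ler_ln ?posrE ?ltr0n// ler_nat.
Qed.

Let w_bound c : exists2 N0, (0 < N0)%N & forall n, (N0 <= n)%N -> c <= w n.
Proof.
have /cvgryPge/(_ c)[N0 _ h] := sqrt_ln_cvgy.
exists N0.+1 => // n hn; apply: h => /=; exact: ltnW.
Qed.

Lemma A_expR n : 0 < w n -> A R n = n%:R * expR (2 * w n - 3 / 2 * ln (w n)).
Proof.
move=> w0; have l0 : 0 < ln n%:R :> R by rewrite -sqrtr_gt0.
have lw : ln (ln n%:R) = 2 * ln (w n) :> R.
  by rewrite -[ln n%:R in LHS](@sqr_sqrtr R) ?ltW// lnXn// mulr2n; ring.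
rewrite /A -mulrA -/(w n); congr (_ * _).
rewrite /powR gt_eqF// -expRN -expRD lw; congr expR; by field.
Qed.

Lemma mparts_asymp : exists2 c : R, 0 < c &
  (fun n => (size (mparts 2 n))%:R / A R n) @ \oo --> c.
Proof.
have [N0 N00 hN0] := w_bound 2.
have wbnd N x : (N0 <= N)%N -> w N <= x <= w N.+1 ->
    2 <= x /\ N%:R <= expR (x ^+ 2) <= N%:R + 1.
  move=> hN /andP[wx xw]; have x2 := le_trans (hN0 _ hN) wx.
  have N_gt0 : (0 < N)%N by exact: leq_trans hN.
  have eN n : (0 < n)%N -> n%:R = expR (w n ^+ 2).
    by move=> n0; rewrite sqr_w// lnK// posrE ltr0n.
  split=> //; rewrite natr1 (eN N)// (eN N.+1)// !ler_expR.
  by apply/andP; split; apply: lerXn2r; rewrite ?nnegrE ?sqrtr_ge0//; lra.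
have pbnd N x : (N0 <= N)%N -> w N <= x <= w N.+1 -> 1 <= mp_p N x.
  move=> hN /(wbnd _ _ hN)[x2 _]; have := mp_p_ge x (leq_trans N00 hN).
  have : 4 <= x ^+ 2 by nra.
  lra.
have odebnd N x : (N0 <= N)%N -> w N <= x <= w N.+1 ->
    `|x ^+ 2 * mp_M N x - mp_p N x| <= 960 * mp_p N x / x ^+ 2.
  move=> hN /(wbnd _ _ hN)[x2 hx]; apply: mp_ode => //; last by nra.
  exact: leq_trans hN.
have [L L0 hL] := liouville_green (C := 960) (ler0n _ _) hN0 w_nd sqrt_ln_cvgy
  (fun N x _ => ider_mp_p N x) (fun N x _ => ider_mp_g N x)
  (@mp_p_glue R) (@mp_g_glue R) pbnd odebnd.
exists L => //.
(* The equation gives M ~ P / v, and n times [phi 0] over v is A(n) at v = ln n. *)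
have h1 : (fun N => w N ^+ 2 * mp_M N (w N) / mp_p N (w N)) @ \oo --> (1 : R).
  apply/cvgrPdist_le => e e0; near=> N.
  have hN : (N0 <= N)%N by near: N; exact: nbhs_infty_ge.
  have hw : w N <= w N <= w N.+1 by rewrite lexx w_nd.
  have p1 := pbnd _ _ hN hw; have := odebnd _ _ hN hw.
  have w2 := hN0 _ hN.
  have we : 960 / e <= w N.
    by near: N; have [N1 _ h] := w_bound (960 / e); exists N1.
  have p0 : 0 < mp_p N (w N) := lt_le_trans ltr01 p1.
  have -> : 1 - w N ^+ 2 * mp_M N (w N) / mp_p N (w N) =
     - ((w N ^+ 2 * mp_M N (w N) - mp_p N (w N)) / mp_p N (w N)).
    by field; rewrite gt_eqF.
  rewrite normrN normrM normfV (gtr0_norm p0) ler_pdivrMr// => h.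
  apply: le_trans h _; rewrite mulrAC ler_pM2r//.
  move: we w2; rewrite ler_pdivrMr//; clear -e0; move: (w N) => x we w2.
  by rewrite ler_pdivrMr ?exprn_gt0//; nra.
have h2 : (fun N => w N ^+ 2 * mp_M N (w N) / mp_p N (w N) *
    (mp_p N (w N) / phi 0 (w N))) @ \oo --> L.
  by rewrite -[L]mul1r; exact: cvgM.
apply: (near_eq_cvgn h2); near=> N.
have hN : (N0 <= N)%N by near: N; exact: nbhs_infty_ge.
have w2 := hN0 _ hN; have w0 : 0 < w N by lra.
have hw : w N <= w N <= w N.+1 by rewrite lexx w_nd.
have p1 := pbnd _ _ hN hw.
have N_gt0 : (0 < N)%N by exact: leq_trans hN.
rewrite A_expR// /mp_M /phi mulr0 mul0r subr0.
have e1 : expR (w N ^+ 2) = N%:R by rewrite sqr_w// lnK// posrE ltr0n.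
have e2 : w N ^+ 2 = expR (2 * ln (w N)) by rewrite expRM_natl lnK.
rewrite expRN e1 e2.
have -> : expR (2 * w N - 3 / 2 * ln (w N)) =
   expR (ln (w N) / 2 + 2 * w N) / expR (2 * ln (w N)).
  by rewrite -expRB; congr expR; field.
have p0 : mp_p N (w N) != 0 by rewrite gt_eqF// (lt_le_trans ltr01 p1).
by field; rewrite p0 !expR_eq0 pnatr_eq0 -lt0n N_gt0.
Unshelve. all: by end_near. Qed.

(** A is regularly varying of index 1: w (m n) - w n is ln (m n / n) over w (m n) + w n, so it tends
    to 0, and the quotient of the w tends to 1. *)
Lemma A_ratio (m : nat -> nat) (rho : R) : 0 < rho ->
  (fun n => (m n)%:R / n%:R : R) @ \oo --> rho ->
  (fun n => A R (m n) / A R n) @ \oo --> rho.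
Proof.
move=> rho0 hm.
have [N0 N00 hN0] := w_bound 2.
have lnC : (fun n => ln ((m n)%:R / n%:R)) @ \oo --> ln rho.
  by apply: continuous_cvg => //; exact: continuous_ln.
have moo B : \forall n \near \oo, B <= (m n)%:R :> R.
  near=> n.
  have n0 : 0 < n%:R :> R by rewrite ltr0n; near: n; exact: nbhs_infty_gt.
  have : rho / 2 <= (m n)%:R / n%:R.
    by near: n; apply: (cvgr_ge rho) => //; lra.
  have : 2 * B / rho <= n%:R by near: n; exact: nbhs_infty_ger.
  rewrite ler_pdivlMr// ler_pdivrMr// => h1; apply: le_trans; lra.
have m0 : \forall n \near \oo, (N0 <= m n)%N.
  by near=> n; rewrite -(ler_nat R); near: n; exact: moo.
have dw : (fun n => w (m n) - w n) @ \oo --> (0 : R).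
  have hb : (fun n => `|ln ((m n)%:R / n%:R : R)| / w n) @ \oo --> (0 : R).
    rewrite -(mulr0 `|ln rho|); apply: cvgM; first exact: cvg_norm.
    apply/gtr0_cvgV0; last exact: sqrt_ln_cvgy.
    by exists N0 => // n /= /hN0 /=; lra.
  have hb' : (fun n => - (`|ln ((m n)%:R / n%:R : R)| / w n)) @ \oo --> (0 : R).
    by rewrite -oppr0; apply: cvgN.
  apply: (squeeze_cvgr _ hb' hb); near=> n.
  have hn : (N0 <= n)%N by near: n; exact: nbhs_infty_ge.
  have hmn : (N0 <= m n)%N by near: n.
  have wn2 := hN0 _ hn; have wm2 := hN0 _ hmn.
  rewrite -ler_norml ler_pdivlMr; last lra.
  have -> : ln ((m n)%:R / n%:R) = (w (m n) - w n) * (w (m n) + w n).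
    rewrite ln_div ?posrE ?ltr0n ?(leq_trans N00)//.
    rewrite -(sqr_w R (leq_trans N00 hn)) -(sqr_w R (leq_trans N00 hmn)).
    by rewrite -/(w n) -/(w (m n)); ring.
  rewrite normrM ler_wpM2l// ger0_norm; lra.
have lw : (fun n => ln (w (m n) / w n)) @ \oo --> (0 : R).
  rewrite -(@ln1 R); apply: continuous_cvg; first exact: continuous_ln.
  have h : (fun n => 1 + (w (m n) - w n) / w n) @ \oo --> (1 + 0 * 0 : R).
    apply: cvgD; first exact: cvg_cst.
    apply: cvgM; first exact: dw.
    apply/gtr0_cvgV0; last exact: sqrt_ln_cvgy.
    by exists N0 => // n /= /hN0 /=; lra.
  rewrite mul0r addr0 in h; apply: (near_eq_cvgn h); near=> n.
  have hn : (N0 <= n)%N by near: n; exact: nbhs_infty_ge.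
  by field; rewrite gt_eqF//; have := hN0 _ hn; lra.
have h : (fun n => (m n)%:R / n%:R *
    expR (2 * (w (m n) - w n) - 3 / 2 * ln (w (m n) / w n))) @ \oo -->
    rho * expR (2 * 0 - 3 / 2 * 0).
  apply: cvgM; first exact: hm.
  apply: continuous_cvg; first exact: continuous_expR.
  by apply: cvgB; apply: cvgM => //; exact: cvg_cst.
rewrite !mulr0 subr0 expR0 mulr1 in h.
apply: (near_eq_cvgn h); near=> n.
have hn : (N0 <= n)%N by near: n; exact: nbhs_infty_ge.
have hmn : (N0 <= m n)%N by near: n.
have wn2 := hN0 _ hn; have wm2 := hN0 _ hmn.
have wn0 : 0 < w n by lra. have wm0 : 0 < w (m n) by lra.
rewrite !A_expR// ln_div//.
set u := 2 * w (m n) - _; set v := 2 * w n - _.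
have -> : 2 * (w (m n) - w n) - 3 / 2 * (ln (w (m n)) - ln (w n)) = u - v.
  by rewrite /u /v; field.
rewrite [expR (u - v)]expRB; field.
by rewrite expR_eq0 pnatr_eq0 -lt0n (leq_trans N00 hn).
Unshelve. all: by end_near. Qed.

End MainAsymptotics.

(** * Limits *)

Section Limits.
Variable R : realType.
Implicit Types (u : nat -> R) (f : nat -> nat).

Lemma A_gt0 n : (1 < n)%N -> 0 < A R n.
Proof.
move=> n1; rewrite /A !mulr_gt0 ?expR_gt0 ?ltr0n ?(ltnW n1)// invr_gt0 powR_gt0//.
by rewrite ln_gt0// ltr1n.
Qed.

(** With w = sqrt (ln n), n / A(n) = e^(3/2 ln w - 2 w) <= e^(-w/2). *)
Lemma linear_negligible : (fun n => n%:R / A R n) @ \oo --> (0 : R).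
Proof.
have h : (fun n => expR (- (Num.sqrt (ln n%:R) / 2))) @ \oo --> (0 : R).
  apply: (cvg_comp (fun n => Num.sqrt (ln n%:R) / 2) (fun x => expR (- x)));
    last exact: cvgr_expR.
  apply: (cvg_comp (fun n => Num.sqrt (ln n%:R)) (fun x => x / 2)); first exact: sqrt_ln_cvgy.
  apply/cvgryPge => B; exists (2 * B); split; first exact: num_real.
  by move=> x /= hx; lra.
apply: (squeeze_cvgr _ (cvg_cst 0) h); near=> n.
have n2 : (1 < n)%N by near: n; exact: nbhs_infty_gt.
have w1 : 1 <= Num.sqrt (ln n%:R) :> R.
  by near: n; have /cvgryPge/(_ 1) := @sqrt_ln_cvgy R.
have w0 : 0 < Num.sqrt (ln n%:R) :> R by lra.
rewrite divr_ge0 ?(ltW (A_gt0 n2))//= A_expR// invfM mulrA divff ?mul1r; last first.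
  by rewrite pnatr_eq0; lia.
rewrite -expRN ler_expR; have := ln_sublinear w0; lra.
Unshelve. all: by end_near. Qed.

Lemma cvg_rescale u (c rho : R) f : 0 < rho ->
  (fun n => u n / A R n) @ \oo --> c -> (fun n => (f n)%:R / n%:R) @ \oo --> rho ->
  (fun n => u (f n) / A R n) @ \oo --> c * rho.
Proof.
move=> rho0 hu hf.
have foo : f @ \oo --> \oo.
  apply/cvgnyPge => B; near=> n.
  have n0 : 0 < n%:R :> R by rewrite ltr0n; near: n; exact: nbhs_infty_gt.
  have : rho / 2 <= (f n)%:R / n%:R by near: n; apply: (cvgr_ge rho) => //; lra.
  have : 2 * B%:R / rho <= n%:R by near: n; exact: nbhs_infty_ger.
  rewrite -(ler_nat R) ler_pdivlMr// ler_pdivrMr// => h1; apply: le_trans; lra.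
have h : (fun n => u (f n) / A R (f n) * (A R (f n) / A R n)) @ \oo --> c * rho.
  apply: cvgM; last exact: A_ratio.
  exact: (cvg_comp f (fun n => u n / A R n) foo hu).
apply: (near_eq_cvgn h); near=> n.
have fn : (1 < f n)%N by near: n; move/cvgnyPge: foo => /(_ 2%N).
by rewrite /= mulrA divfK// gt_eqF// A_gt0.
Unshelve. all: by end_near. Qed.

Lemma cvg_divn_ratio d : (0 < d)%N ->
  (fun n => (n %/ d)%:R / n%:R) @ \oo --> (d%:R^-1 : R).
Proof.
move=> d0; have d0R : 0 < d%:R :> R by rewrite ltr0n.
have h : (fun n => d%:R^-1 - n%:R^-1) @ \oo --> (d%:R^-1 - 0 : R).
  apply: cvgB; first exact: cvg_cst.
  apply/gtr0_cvgV0; last exact: cvgr_idn.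
  by exists 1%N => // n /= n1; rewrite ltr0n.
rewrite subr0 in h.
apply: (squeeze_cvgr _ h (cvg_cst _)); near=> n.
have n0 : 0 < n%:R :> R by rewrite ltr0n; near: n; exact: nbhs_infty_gt.
have h1 : (n %/ d)%:R * d%:R <= n%:R :> R by rewrite -natrM ler_nat leq_divM.
have h2 : n%:R <= ((n %/ d)%:R + 1) * d%:R :> R.
  by rewrite natr1 -natrM ler_nat ltnW// ltn_ceil.
rewrite -subr_ge0 -[X in _ && X]subr_ge0.
have -> : (n %/ d)%:R / n%:R - (d%:R^-1 - n%:R^-1) =
    ((n %/ d)%:R * d%:R + d%:R - n%:R) / (n%:R * d%:R) :> R.
  by field; rewrite !gt_eqF.
have -> : d%:R^-1 - (n %/ d)%:R / n%:R =
    (n%:R - (n %/ d)%:R * d%:R) / (n%:R * d%:R) :> R.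
  by field; rewrite !gt_eqF.
by rewrite !divr_ge0 ?mulr_ge0 ?subr_ge0//; lra.
Unshelve. all: by end_near. Qed.

Section MpartsLimits.
Variable c : R.
Hypothesis c0 : 0 < c.
Hypothesis hc : (fun n => (size (mparts 2 n))%:R / A R n) @ \oo --> c.

(** Passing from d to d + 1 multiplies the limit by 1 - 1 / d, so that it is c / (d - 1). *)
Lemma cvg_mparts d : (2 <= d)%N -> exists2 e : R, 0 <= e &
  (fun n => (size (mparts d n))%:R / A R n) @ \oo --> e.
Proof.
move=> d2; have -> : d = (d - 2 + 2)%N by rewrite subnK.
elim: (d - 2)%N => [|k [e e0 he]]; first by exists c => //; exact: ltW.
set m := (k + 2)%N in he *.
have m2 : (2 <= m)%N by rewrite /m leq_addl.
have m0 : (0 < m)%N by exact: ltnW.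
have hm : (fun n => (size (mparts m.+1 n))%:R / A R n) @ \oo --> e - e * m%:R^-1.
  have -> : (fun n => (size (mparts m.+1 n))%:R / A R n) = (fun n =>
      (size (mparts m n))%:R / A R n - (size (mparts m (n %/ m)))%:R / A R n).
    apply/funext => n; rewrite -mulrBl; congr (_ / _).
    by rewrite (size_mpartsS n m2) natrD addrK.
  apply: cvgB => //.
  apply: (cvg_rescale (u := fun n => (size (mparts m n))%:R)) => //.
    by rewrite invr_gt0 ltr0n.
  exact: cvg_divn_ratio.
rewrite addSn; exists (e - e * m%:R^-1) => //.
rewrite subr_ge0 ler_piMr// invf_le1 ?ltr0n// ler1n//.
Qed.

(** The stretched argument n + n / r costs a factor 1 + 1 / r, with r arbitrary, and the linear term
    is o(A(n)). *)
Lemma cvg_goods : (fun n => (size (goods n))%:R / A R n) @ \oo --> c.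
Proof.
apply/cvgrPdist_le => eps eps0.
pose r := (Num.trunc (4 * c / eps)).+1.
have r0R : 0 < r%:R :> R by rewrite ltr0n.
have hr : c / r%:R <= eps / 4.
  have : 4 * c / eps < r%:R by apply: truncnS_gt.
  rewrite ltr_pdivrMr// ler_pdivrMr// => h; lra.
have [K hK] := size_goods_le (ltn0Sn (Num.trunc (4 * c / eps))); rewrite -/r in hK.
have hn0 := linear_negligible.
have hup : (fun n => (size (mparts 2 (n + n %/ r)))%:R / A R n + K%:R * (n%:R / A R n))
    @ \oo --> c * (1 + r%:R^-1) + K%:R * 0.
  apply: cvgD; last by apply: cvgM => //; exact: cvg_cst.
  apply: (cvg_rescale (u := fun n => (size (mparts 2 n))%:R)) => //.
  have h : (fun n => 1 + (n %/ r)%:R / n%:R) @ \oo --> (1 + r%:R^-1 : R).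
    by apply: cvgD; [exact: cvg_cst|exact: cvg_divn_ratio].
  apply: (near_eq_cvgn h); near=> n.
  have n0 : n%:R != 0 :> R by rewrite pnatr_eq0 -lt0n; near: n; exact: nbhs_infty_gt.
  by rewrite natrD mulrDl divff.
have hlo : (fun n => (size (mparts 2 n))%:R / A R n - n%:R / A R n) @ \oo --> c - 0.
  by apply: cvgB.
rewrite mulr0 addr0 in hup; rewrite subr0 in hlo.
near=> n.
have n1 : (1 < n)%N by near: n; exact: nbhs_infty_gt.
have an := A_gt0 n1.
have u1 : (size (mparts 2 (n + n %/ r)))%:R / A R n + K%:R * (n%:R / A R n) <=
    c * (1 + r%:R^-1) + eps / 4.
  by near: n; apply: (cvgr_le _ hup); rewrite ltrDl divr_gt0.
have l1 : c - eps <= (size (mparts 2 n))%:R / A R n - n%:R / A R n.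
  by near: n; apply: (cvgr_ge _ hlo); rewrite ltrBlDr ltrDl.
have u2 : (size (goods n))%:R / A R n <=
    (size (mparts 2 (n + n %/ r)))%:R / A R n + K%:R * (n%:R / A R n).
  rewrite mulrA -mulrDl ler_pM2r ?invr_gt0// -natrM -natrD ler_nat.
  by apply: hK; exact: ltnW.
have l2 : (size (mparts 2 n))%:R / A R n - n%:R / A R n <= (size (goods n))%:R / A R n.
  rewrite -mulrBl ler_pM2r ?invr_gt0// lerBlDr -natrD ler_nat.
  apply: leq_trans (size_mparts_goods (ltnW n1)) _.
  by rewrite leq_add2r count_size.
rewrite ler_distlC; apply/andP; split; first exact: le_trans l1 l2.
apply: le_trans u2 _; apply: le_trans u1 _; rewrite mulrDr mulr1; lra.
Unshelve. all: by end_near. Qed.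

(** For fixed D the partial sums [y D] converge; their limits increase and are at most c. The
    remainder is at most [t n / D], uniformly in n, which allows the interchange of limits. *)
Lemma cvg_count_tail_mparts : exists e : R,
  (fun n => (count tail_eq (mparts 2 n))%:R / A R n) @ \oo --> e.
Proof.
pose y D n : R := \sum_(2 <= d < D.+1) (size (mparts d (n %/ d ^ 2)))%:R / A R n.
pose x n : R := (count tail_eq (mparts 2 n))%:R / A R n.
pose t n : R := (size (mparts 2 n))%:R / A R n.
have hy D : exists e : R, y D @ \oo --> e.
  elim: D => [|D [e he]].
    exists 0; have -> : y 0%N = fun=> 0 by apply/funext => n; rewrite /y big_geq.
    exact: cvg_cst.
  have [D1|D1] := leqP 1 D; last first.
    exists 0; have -> : y D.+1 = fun=> 0 by apply/funext => n; rewrite /y big_geq.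
    exact: cvg_cst.
  have [e' _ he'] := cvg_mparts (d := D.+1) D1.
  have h : (fun n => (size (mparts D.+1 (n %/ D.+1 ^ 2)))%:R / A R n) @ \oo -->
      e' * ((D.+1 ^ 2)%:R)^-1.
    apply: (cvg_rescale (u := fun n => (size (mparts D.+1 n))%:R)) => //.
    by apply: cvg_divn_ratio; rewrite expn_gt0.
  exists (e + e' * ((D.+1 ^ 2)%:R)^-1).
  have -> : y D.+1 = fun n => y D n + (size (mparts D.+1 (n %/ D.+1 ^ 2)))%:R / A R n.
    by apply/funext => n; rewrite /y big_nat_recr.
  exact: cvgD.
have [e he] := choice hy.
have yx D n : (1 < n)%N -> y D.+1 n <= x n <= y D.+1 n + t n / D.+1%:R.
  move=> n1; have an := A_gt0 n1.
  rewrite /y -mulr_suml -natr_sum /x (count_tail_split D.+1 n) natrD mulrDl lerDl lerD2l.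
  apply/andP; split; first by rewrite divr_ge0// ltW.
  rewrite mulrAC ler_pM2r ?invr_gt0// ler_pdivlMr ?ltr0n// mulrC -natrM ler_nat.
  exact: count_tail_large.
have e_nd : nondecreasing_seq (fun D => e D.+1).
  apply/nondecreasing_seqP => D; apply: (ler_cvg_to (he _) (he _)); near=> n.
  have n1 : (1 < n)%N by near: n; exact: nbhs_infty_gt.
  by rewrite /y [leRHS]big_nat_recr//= lerDl divr_ge0// ltW// A_gt0.
have e_c D : e D.+1 <= c.
  apply: (ler_cvg_to (he _) hc); near=> n.
  have n1 : (1 < n)%N by near: n; exact: nbhs_infty_gt.
  have /andP[h _] := yx D _ n1; apply: le_trans h _.
  by rewrite /x ler_pM2r ?invr_gt0 ?A_gt0// ler_nat count_size.
have /cvg_ex[/= l hl] : cvgn (fun D => e D.+1).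
  by apply: nondecreasing_is_cvgn => //; exists c => _ [D _ <-].
exists l; apply/cvgrPdist_le => eps eps0.
have [D hD1 hD2] : exists2 D, `|l - e D.+1| <= eps / 4 & 2 * c / D.+1%:R <= eps / 4.
  have h1 : \forall D \near \oo, `|l - e D.+1| <= eps / 4.
    by move/cvgrPdist_le : hl; apply; rewrite divr_gt0.
  have h2 : \forall D \near \oo, 2 * c / D.+1%:R <= eps / 4.
    near=> D; rewrite ler_pdivrMr ?ltr0n//.
    have : 8 * c / eps <= D%:R by near: D; exact: nbhs_infty_ger.
    by rewrite ler_pdivrMr// -natr1; nra.
  have [D [? ?]] := @filter_ex _ _ _ _ (filterI h1 h2).
  by exists D.
near=> n.
have n1 : (1 < n)%N by near: n; exact: nbhs_infty_gt.
have h1 : `|e D.+1 - y D.+1 n| <= eps / 4.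
  by near: n; move/cvgrPdist_le : (he D.+1); apply; rewrite divr_gt0.
have h2 : t n <= 2 * c.
  by near: n; apply: (cvgr_le _ hc); rewrite ltr_pMl// ltr1n.
have h3 : t n / D.+1%:R <= eps / 4.
  by apply: le_trans hD2; rewrite ler_pM2r ?invr_gt0 ?ltr0n.
have /andP[] := yx D _ n1.
move: h1 hD1 h3; rewrite -/(x n) !ler_norml; clear -eps0.
move: (x n) (y D.+1 n) (t n / _) (e D.+1) => X Y T E.
by move=> /andP[? ?] /andP[? ?] ? ? ?; apply/andP; split; lra.
Unshelve. all: by end_near. Qed.

Lemma cvg_count_tail_goods : exists e : R,
  (fun n => (count tail_eq (goods n))%:R / A R n) @ \oo --> e.
Proof.
have [e he] := cvg_count_tail_mparts; exists e.
have h : (fun n => (count tail_eq (mparts 2 n))%:R / A R n + ((size (goods n))%:R / A R n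
    - (size (mparts 2 n))%:R / A R n + n%:R / A R n)) @ \oo --> e + (c - c + 0).
  apply: cvgD => //; apply: cvgD; last exact: linear_negligible.
  by apply: cvgB => //; exact: cvg_goods.
rewrite subrr !addr0 in h.
apply: (squeeze_cvgr _ he h); near=> n.
have n1 : (1 < n)%N by near: n; exact: nbhs_infty_gt.
have an := A_gt0 n1.
rewrite -mulrBl -!mulrDl !ler_pM2r ?invr_gt0// ler_nat count_tail_mparts /=.
have := count_tail_goods (ltnW n1); rewrite -(ler_nat R) !natrD; lra.
Unshelve. all: by end_near. Qed.

(** The limit is 2 c - e, with e the share of equal last entries. It is at least c because the
    comparisons that fit already outnumber [goods n]. *)
Lemma cvg_Theta : exists2 l : R, c <= l & (fun n => (Theta n)%:R / A R n) @ \oo --> l.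
Proof.
have [e he] := cvg_count_tail_goods.
have hg := cvg_goods.
have hg1 : (fun n => (size (goods n.-1))%:R / A R n) @ \oo --> c * 1.
  apply: (cvg_rescale (u := fun n => (size (goods n))%:R)) => //.
  have h : (fun n : nat => 1 - n%:R^-1) @ \oo --> (1 - 0 : R).
    apply: cvgB; first exact: cvg_cst.
    apply/gtr0_cvgV0; last exact: cvgr_idn.
    by exists 1%N => // n /= n1; rewrite ltr0n.
  rewrite subr0 in h; apply: (near_eq_cvgn h); near=> n.
  have n0 : (0 < n)%N by near: n; exact: nbhs_infty_gt.
  by rewrite -subn1 natrB// mulrBl mul1r divff// pnatr_eq0 -lt0n.
pose l := c + c * 1 - e + 2 * 0.
have hl : (fun n => (Theta n)%:R / A R n) @ \oo --> l.
  have h : (fun n => (size (goods n))%:R / A R n + (size (goods n.-1))%:R / A R n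
      - (count tail_eq (goods n))%:R / A R n + 2 * ((n.-1)%:R / A R n)) @ \oo --> l.
    apply: cvgD; first by apply: cvgB => //; exact: cvgD.
    apply: cvgM; first exact: cvg_cst.
    apply: (squeeze_cvgr _ (cvg_cst 0) linear_negligible); near=> n.
    have n1 : (1 < n)%N by near: n; exact: nbhs_infty_gt.
    rewrite divr_ge0 ?(ltW (A_gt0 n1))//= ler_pM2r ?invr_gt0 ?A_gt0//.
    by rewrite ler_nat leq_pred.
  apply: (near_eq_cvgn h); near=> n.
  have n1 : (1 < n)%N by near: n; exact: nbhs_infty_gt.
  have := congr1 (fun k => k%:R : R) (Theta_goods n1); rewrite !natrD => H.
  have -> : (Theta n)%:R = (n.-1)%:R + (size (goods n))%:R
     + ((n.-1)%:R + (size (goods n.-1))%:R) - (count tail_eq (goods n))%:R :> R by rewrite -H addrK.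
  by ring.
exists l => //; apply: (ler_cvg_to hg hl); near=> n.
have n1 : (1 < n)%N by near: n; exact: nbhs_infty_gt.
rewrite ler_pM2r ?invr_gt0 ?A_gt0// ler_nat.
have := Theta_goods n1; have := sum_misfits n1; lia.
Unshelve. all: by end_near. Qed.

End MpartsLimits.

End Limits.

(** Of the factor 4, two units cover the two lists in [Theta_goods] and two cover 2 (n - 1). *)
Lemma Theta_bounds n : (1 < n)%N ->
  (size (goods n) <= Theta n <= 4 * size (goods n))%N.
Proof.
move=> n1; have := Theta_goods n1; have := sum_misfits n1.
have := pred_leq_goods n; have := leq_goods n; lia.
Qed.

Theorem theorem2p5 (R : realType) :
  (exists c C : R, [/\ 0 < c, 0 < C &
     forall n : nat, (3 <= n)%N ->
       c * (nb_solutions_le n)%:R <= (Theta n)%:R <= C * (nb_solutions_le n)%:R])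
  /\
  (exists b B : R,
     [/\ 0 < b, b < B,
         cvgn (fun n : nat => (Theta n)%:R / A R n : R) &
         b <= limn (fun n : nat => (Theta n)%:R / A R n : R) <= B]).
Proof.
split.
  exists 1, 4; split=> // n n3; rewrite nb_solutions_goods mul1r -natrM !ler_nat.
  by apply: Theta_bounds; exact: ltnW.
have [c c0 hc] := mparts_asymp R; have [l cl hl] := cvg_Theta c0 hc.
(* The 1 makes b < B strict even if l = c. *)
exists c, (l + 1); split=> //; first by rewrite (le_lt_trans cl)// ltrDl.
  exact: cvgP hl.
by rewrite (cvg_lim _ hl)// cl lerDl ler01.
Qed.
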